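(* Let $p$ be a prime and let $\mathcal{F}$ be a saturated fusion system on the finite $p$-group $S$. Let $T$ be a proper normal subgroup of $S$ with $S/T$ abelian. Let $u \in S - T$ and let $\mathcal{I}$ be the set of fully $\mathcal{F}$-centralized $\mathcal{F}$-conjugates of $u$ lying in $S - T$. Assume that (1) $u$ is of least order in $S - T$ (that is, $|u| \leq |s|$ for every $s \in S - T$), and (2) the set of cosets $\mathcal{I}T = \{vT \mid v \in \mathcal{I}\}$ is linearly independent in $\Omega_1(S/T)$. If $u \in \mathfrak{foc}(\mathcal{F})$, then $u$ has a fully $\mathcal{F}$-centralized $\mathcal{F}$-conjugate in $T$.
   Context: Saturated fusion systems on finite $p$-groups are taken in the standard sense. Maps are composed left-to-right, and for $s\in S$ and $\varphi \in \operatorname{Hom}_{\mathcal{F}}(\langle s\rangle, S)$ the image of $s$ under $\varphi$ is written $s^\varphi$. $S-T$ denotes the set-theoretic difference. An $\mathcal{F}$-conjugate of an element $u\in S$ is an element of the form $u^\varphi$ with $\varphi\in\operatorname{Hom}_{\mathcal{F}}(\langle u\rangle,S)$. A subgroup $P\le S$ is fully $\mathcal{F}$-centralized if $|C_S(P)|\ge |C_S(P^\varphi)|$ for every $\varphi\in\operatorname{Hom}_{\mathcal{F}}(P,S)$; an element $v\in S$ is fully $\mathcal{F}$-centralized if $\langle v\rangle$ is. The focal subgroup is $\mathfrak{foc}(\mathcal{F}) = \langle s^{-1}s^{\varphi} \mid s\in S,\ \varphi\in\operatorname{Hom}_{\mathcal{F}}(\langle s\rangle,S)\rangle \le S$. For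 an abelian $p$-group $A$, $\Omega_1(A)$ is the subgroup of elements of order dividing $p$, regarded as a vector space over $\mathbb{F}_p$; linear independence is over $\mathbb{F}_p$. (By (1), $u^p \in T$ and likewise $v^p\in T$ for all $v\in\mathcal{I}$, so that $\mathcal{I}T\subseteq\Omega_1(S/T)$.) *)

(* Defs.v *)
From HB Require Import structures.
From mathcomp Require Import all_boot all_order all_algebra all_fingroup.
From mathcomp Require Import all_solvable all_field all_character.

Set Implicit Arguments.
Unset Strict Implicit.
Unset Printing Implicit Defensive.

Local Open Scope group_scope.

(* A homomorphism P -> Q is represented by every function gT -> gT extending  *)
(* it: fs_ext makes membership in HomF P Q depend only on the values on P.    *)
(* HomF P Q is unconstrained, and never used, unless P and Q are both         *)
(* subgroups of S.                                                            *)
Record fusion_system (gT : finGroupType) (S : {group gT}) := FusionSystem {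
  HomF : {group gT} -> {group gT} -> {set {ffun gT -> gT}};
  fs_ext : forall (P Q : {group gT}) (f g : {ffun gT -> gT}),
    P \subset S -> Q \subset S ->
    {in P, f =1 g} -> f \in HomF P Q -> g \in HomF P Q;
  fs_inj : forall (P Q : {group gT}) (f : {ffun gT -> gT}),
    P \subset S -> Q \subset S -> f \in HomF P Q ->
    [/\ {in P &, {morph f : x y / x * y}}, {in P &, injective f}
      & f @: P \subset Q];
  fs_conj : forall (P Q : {group gT}) (s : gT),
    P \subset S -> Q \subset S -> s \in S -> P :^ s \subset Q ->
    [ffun x => x ^ s] \in HomF P Q;
  fs_comp : forall (P Q R : {group gT}) (f g : {ffun gT -> gT}),
    P \subset S -> Q \subset S -> R \subset S ->
    f \in HomF P Q -> g \in HomF Q R -> [ffun x => g (f x)] \in HomF P R;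
  (* Every morphism is an isomorphism of the category followed by an          *)
  (* inclusion.                                                               *)
  fs_iso : forall (P Q R : {group gT}) (f : {ffun gT -> gT}),
    P \subset S -> Q \subset S -> f \in HomF P Q -> f @: P = R ->
    f \in HomF P R /\ exists2 g, g \in HomF R P & {in P, cancel f g}
}.

Section FusionDefs.

Variables (gT : finGroupType) (S : {group gT}) (F : fusion_system S).
Implicit Types (P Q : {group gT}) (f : {ffun gT -> gT}) (u v : gT).

Definition fully_centralized P : bool :=
  [forall f in HomF F P S, (#|'C_S(f @: P)| <= #|'C_S(P)|)%N].

Definition fully_normalized P : bool :=
  [forall f in HomF F P S, (#|'N_S(f @: P)| <= #|'N_S(P)|)%N].

Definition AutF P : {set {perm gT}} :=
  [set a in Aut P | [ffun x => a x] \in HomF F P P].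

Definition AutS P : {set {perm gT}} := conj_aut P @* 'N_S(P).

(* N_f is the set of g in N_S(P) such that f^-1 c_g f lies in Aut_S(P^f).     *)
Definition Nphi P f : {set gT} :=
  [set g in 'N_S(P) | [exists h in 'N_S(f @: P),
                        [forall x in P, f (x ^ g) == f x ^ h]]].

Lemma group_set_Nphi P f : group_set (Nphi P f).
Proof.
apply/group_setP; split=> [|g1 g2].
  rewrite inE group1; apply/existsP; exists 1; rewrite group1 /=.
  by apply/forall_inP=> x _; rewrite !conjg1.
rewrite 3!{1}[_ \in Nphi _ _]in_set.
move=> /andP[Ng1 /exists_inP[h1 Nh1 /forall_inP f1]].
move=> /andP[Ng2 /exists_inP[h2 Nh2 /forall_inP f2]].
rewrite groupM //=; case/setIP: Ng1 => _ nPg1.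
apply/exists_inP; exists (h1 * h2); first by rewrite groupM.
apply/forall_inP=> x Px; rewrite !conjgM.
by rewrite (eqP (f2 _ _)) ?memJ_norm // (eqP (f1 _ _)).
Qed.

Canonical Nphi_group P f := Group (group_set_Nphi P f).

(* The Broto-Levi-Oliver axioms.                                              *)
Definition saturated (p : nat) : Prop :=
  (forall P, P \subset S -> fully_normalized P ->
     fully_centralized P /\ p.-Sylow(AutF P) (AutS P))
  /\ (forall P Q f, P \subset S -> f \in HomF F P S -> f @: P = Q ->
     fully_centralized Q ->
     exists2 g, g \in HomF F (Nphi_group P f) S & {in P, g =1 f}).

Definition Fconjugates u : {set gT} :=
  [set (f : {ffun gT -> gT}) u | f in HomF F <[u]>%G S].

Definition focal : {set gT} :=
  << [set s^-1 * (f : {ffun gT -> gT}) s | s in S, f in HomF F <[s]>%G S] >>.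

End FusionDefs.

(* Linear independence over 'F_p of a subset of a nontrivial elementary       *)
(* abelian group E, identified by abelem_rV with a space of row vectors.      *)
Definition lin_indep (p : nat) (gT : finGroupType) (E : {group gT})
    (abelE : p.-abelem E) (ntE : E :!=: 1) (A : {set gT}) : bool :=
  free [seq abelem_rV abelE ntE x | x <- enum A].

Lemma Ohm1_quotient_abelem (p : nat) (gT : finGroupType) (S T : {group gT}) :
  p.-group S -> abelian (S / T) -> p.-abelem 'Ohm_1(S / T).
Proof. by move=> pS; apply: Ohm1_abelem; apply: quotient_pgroup. Qed.

Lemma Ohm1_quotient_neq1 (gT : finGroupType) (S T : {group gT}) :
  T <| S -> T \proper S -> 'Ohm_1(S / T) :!=: 1.
Proof.
case/andP=> _ nTS ltTS; rewrite /= Ohm1_eq1; apply/eqP/trivgP.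
by rewrite quotient_sub1 // -[_ \subset _]negbK proper_subn.
Qed.

(* Main.v *)
Require Import Defs.
From HB Require Import structures.
From mathcomp Require Import all_boot all_order all_algebra all_fingroup.
From mathcomp Require Import all_solvable all_field all_character.

Set Implicit Arguments.
Unset Strict Implicit.
Unset Printing Implicit Defensive.

Local Open Scope group_scope.
(* Transfer, with a one-sided substitute for the characteristic biset of F.   *)
(* With gamma : S -> S / T, every pair q = (R, gamma o phi), where phi is in  *)
(* Hom_F(R, S), has a transfer S -> S / T.  By downward induction on |R|,     *)
(* saturation yields integers c_q such that the monomial marks of the formal  *)
(* sum of the c_q q are constant on F-classes, while sum_q c_q |S : R| is     *)
(* prime to p.  The combined transfer tau is then F-invariant and vanishes on *)
(* foc(F).  Let v be a fully centralized conjugate of u.  As |u| is minimal,  *)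
(* only the cosets xR fixed by v contribute to tau(v), and modulo p only      *)
(* those fixed by C_S(v); such a coset contributes gamma(w), where            *)
(* w = phi(v^x) is again fully centralized.  If no w lies in T, the           *)
(* multiplicities of the elements of IT add up to a number prime to p, so     *)
(* linear independence gives tau(v) != 0, a contradiction.                    *)

(** * Morphisms of a fusion system *)

(** In a finite group with Sylow subgroup $S$, transfer into $S/T$ restricted to $S$ splits by
    Mackey's formula into transfers from $S$ to subgroups $R$, each followed by a fusion map $R \to
    S$ and the quotient map. What makes it useful is that it is fusion-invariant and has degree
    prime to $p$. The proof rebuilds a sum with these two features from $\mathcal{F}$ alone.

    [exists_stable_combination] finds the integer coefficients. Starting from the characters of $S$
    itself, the marks are made constant on $\mathcal{F}$-classes, one order of subgroup at a time. A
    correction at a pair must be an integral multiple of the mark of the pair at itself. This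
    divisibility is [markZ_receptive_mod], where the extension axiom enters through
    [receptive_extend]. The degree is unaffected modulo $p$, because proper subgroups have index
    divisible by $p$.

    [stable_transfer] turns this into an $\mathcal{F}$-invariant homomorphism: marks at the powers
    of an element determine its orbit lengths and factors ([power_sums_inj]), hence its transfer.
    Such a homomorphism kills the focal subgroup, so it vanishes at $u$ and at a fully centralized
    conjugate $v$. By minimality of $|u|$ only cosets fixed by $v$ contribute there. By
    [markZ_pgroup_mod] and [markZ_centralizer_neq0], if no fully centralized conjugate lies in $T$,
    then only values in $\mathcal{I}T$ have multiplicity prime to $p$. Linear independence
    ([abelem_prod_expn]) makes these multiplicities divisible by $p$ too. But their total is the
    degree modulo $p$ ([sum_markZ_values], [markZ_degree]), a contradiction. *)

Section FusionBasics.

Variables (gT : finGroupType) (S : {group gT}) (F : fusion_system S).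
Implicit Types (P Q R : {group gT}) (f g : {ffun gT -> gT}).

(** Inclusions are obtained as conjugation by 1, so restriction is composition with an inclusion. *)
Lemma HomF_restr P P' Q f :
    P' \subset P -> P \subset S -> Q \subset S ->
  f \in HomF F P Q -> f \in HomF F P' Q.
Proof.
move=> sP'P sPS sQS Ff; have sP'S := subset_trans sP'P sPS.
have F1 := @fs_conj _ _ F P' P 1 sP'S sPS (group1 S).
rewrite conjsg1 in F1; have := fs_comp sP'S sPS sQS (F1 sP'P) Ff.
by apply: fs_ext => // x _; rewrite !ffunE conjg1.
Qed.

Lemma HomF_widen P Q Q' f :
    Q \subset Q' -> P \subset S -> Q' \subset S ->
  f \in HomF F P Q -> f \in HomF F P Q'.
Proof.
move=> sQQ' sPS sQ'S Ff; have sQS := subset_trans sQQ' sQ'S.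
have F1 := @fs_conj _ _ F Q Q' 1 sQS sQ'S (group1 S).
rewrite conjsg1 in F1; have := fs_comp sPS sQS sQ'S Ff (F1 sQQ').
by apply: fs_ext => // x _; rewrite !ffunE conjg1.
Qed.

Lemma HomF_id P Q : P \subset Q -> Q \subset S -> [ffun x => x] \in HomF F P Q.
Proof.
move=> sPQ sQS; have sPS := subset_trans sPQ sQS.
have F1 := @fs_conj _ _ F P Q 1 sPS sQS (group1 S).
rewrite conjsg1 in F1; apply: fs_ext (F1 sPQ) => // x _.
by rewrite !ffunE conjg1.
Qed.

Lemma HomF_morphism P f :
    P \subset S -> f \in HomF F P S ->
  exists2 h : {morphism P >-> gT}, 'injm h & h =1 f.
Proof.
move=> sPS Ff; have [fM fI _] := fs_inj sPS (subxx S) Ff.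
by exists (Morphism fM) => //; apply/injmP.
Qed.

Lemma HomF_inv P f :
    P \subset S -> f \in HomF F P S ->
  exists Q : {group gT}, [/\ Q \subset S, f @: P = Q, f \in HomF F P Q &
    exists g, [/\ g \in HomF F Q P, {in P, cancel f g} & {in Q, cancel g f}]].
Proof.
move=> sPS Ff; have [h injh hE] := HomF_morphism sPS Ff.
have defQ : f @: P = (h @* P)%G.
  by rewrite /= morphimEdom; apply: eq_imset => x; rewrite hE.
have sQS : h @* P \subset S.
  by have [_ _] := fs_inj sPS (subxx S) Ff; rewrite defQ.
have [FfQ [g Fg fK]] := fs_iso sPS (subxx S) Ff defQ.
exists (h @* P)%G; split=> //; exists g; split=> // y.
by rewrite -defQ => /imsetP[x Px ->]; rewrite fK.
Qed.

Lemma HomF_trans P f g :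
    P \subset S -> f \in HomF F P S ->
    forall Q, f @: P = Q -> g \in HomF F Q S ->
  [ffun x => g (f x)] \in HomF F P S.
Proof.
move=> sPS Ff Q defQ Fg; have [Q' [sQ'S defQ' FfQ _]] := HomF_inv sPS Ff.
have eqQ : Q = Q' by apply/val_inj; rewrite /= -defQ.
by rewrite eqQ in Fg *; apply: fs_comp FfQ Fg.
Qed.

Lemma HomF_mem P f x : P \subset S -> f \in HomF F P S -> x \in P -> f x \in S.
Proof.
move=> sPS Ff Px; have [_ _ /subsetP->//] := fs_inj sPS (subxx S) Ff.
exact: imset_f.
Qed.

Lemma HomF_J P f x y :
    P \subset S -> f \in HomF F P S -> x \in P -> y \in P ->
  f (x ^ y) = f x ^ f y.
Proof.
move=> sPS Ff Px Py; have [h _ hE] := HomF_morphism sPS Ff.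
by rewrite -!hE morphJ.
Qed.

End FusionBasics.

(** * Monomial marks *)

Section CosetMarks.

Variables (gT aT : finGroupType) (S : {group gT}) (A : {group aT}).
Hypothesis abA : abelian A.
Implicit Types (q : {group gT} * {ffun gT -> aT}) (D B : {set gT}).
Implicit Types (P H : {group gT}) (al be : gT -> aT).

Definition char_pair q : Prop :=
  [/\ q.1 \subset S, {in q.1 &, {morph q.2 : x y / x * y}}
    & {in q.1, forall x, q.2 x \in A}].

Lemma char_pairJ q x y :
  char_pair q -> x \in q.1 -> y \in q.1 -> q.2 (x ^ y) = q.2 x.
Proof.
case=> _ qM qA Rx Ry; have := qM y (x ^ y) Ry (groupJ Rx Ry).
rewrite -conjgC qM // (centsP abA _ (qA x Rx) _ (qA y Ry)).
by move/mulgI.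
Qed.

Lemma char_pairX q x n : char_pair q -> x \in q.1 -> q.2 (x ^+ n) = q.2 x ^+ n.
Proof. by case=> _ qM _ Rx; exact: (morphX (Morphism qM)). Qed.

Definition mark_set q D B al : {set gT} :=
  [set x in S | (D :^ x \subset q.1) && [forall g in B, q.2 (g ^ x) == al g]].

Definition mark_cosets q D B al : {set {set gT}} :=
  [set x *: q.1 | x in mark_set q D B al].

(* The cosets of R = q.1 fixed by D on which the restriction to B of the      *)
(* stabilizer character is al: the monomial analogue of the table of marks.   *)
Definition mark q D B al : nat := #|mark_cosets q D B al|.

Lemma mark_setP q D B al x :
  reflect [/\ x \in S, D :^ x \subset q.1
            & {in B, forall g, q.2 (g ^ x) = al g}]
          (x \in mark_set q D B al).
Proof.
rewrite inE; apply: (iffP and3P) => -[Sx sDR eqB]; split=> //.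
  by move=> g Bg; apply/eqP; apply: (forall_inP eqB).
by apply/forall_inP=> g Bg; apply/eqP; apply: eqB.
Qed.

Lemma mark_set_mulr q D B al x r :
    char_pair q -> B \subset D -> r \in q.1 ->
  x \in mark_set q D B al -> x * r \in mark_set q D B al.
Proof.
move=> qP sBD Rr /mark_setP[Sx sDR eqB]; have [sRS _ _] := qP.
apply/mark_setP; split; first by rewrite groupM ?(subsetP sRS r).
  have: (D :^ x) :^ r \subset q.1 :^ r by rewrite conjSg.
  by rewrite conjGid // conjsgM.
move=> g Bg; rewrite conjgM char_pairJ ?eqB //.
by apply: (subsetP sDR); rewrite memJ_conjg (subsetP sBD).
Qed.

Lemma mem_mark_cosets q D B al x :
    char_pair q -> B \subset D ->
  (x *: q.1 \in mark_cosets q D B al) = (x \in mark_set q D B al).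
Proof.
move=> qP sBD; apply/imsetP/idP=> [[y My eqxy] | Mx]; last by exists x.
have: x \in y *: q.1 by rewrite -eqxy lcoset_refl.
by case/lcosetP=> r Rr ->; apply: mark_set_mulr.
Qed.

Lemma card_mark_set q D B al :
  char_pair q -> B \subset D -> #|mark_set q D B al| = (mark q D B al * #|q.1|)%N.
Proof.
move=> qP sBD; rewrite -sum1_card.
rewrite (partition_big (fun x => x *: q.1) (mem (mark_cosets q D B al))) /=; last first.
  by move=> x Mx; rewrite mem_mark_cosets.
rewrite /mark -sum_nat_const; apply: eq_bigr => C /imsetP[y My ->].
rewrite -(card_lcoset q.1 y) -sum1_card; apply: eq_bigl => x.
apply/andP/idP=> [[_ /eqP <-] | yRx]; first exact: lcoset_refl.
have eqC := lcoset_eqP yRx; split; last exact/eqP.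
by rewrite -(mem_mark_cosets _ _ qP sBD) eqC mem_mark_cosets.
Qed.

(** Left translation on the cosets $xR$, inverted to give a right action. *)
Fact lcoset_act_subproof : is_action [set: gT] (fun (C : {set gT}) h => h^-1 *: C).
Proof.
split=> [h C1 C2 /lcoset_inj // | C h1 h2 _ _].
by rewrite invMg lcosetM.
Qed.
Definition lcoset_act := Action lcoset_act_subproof.

Definition stabilizes H B al :=
  {in H & B, forall h g, g ^ h \in B /\ al (g ^ h) = al g}.

Lemma acts_mark_cosets q D B al H :
    char_pair q -> B \subset D -> H \subset S -> H \subset 'N(D) ->
    stabilizes H B al ->
  [acts H, on mark_cosets q D B al | lcoset_act].
Proof.
move=> qP sBD sHS nDH stH; apply/subsetP=> h Hh; rewrite !inE /=.
apply/subsetP=> _ /imsetP[x /mark_setP[Sx sDR eqB] ->]; rewrite inE /=.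
rewrite -lcosetM mem_mark_cosets //; have Hh' := groupVr Hh.
apply/mark_setP; split; first by rewrite groupM ?(subsetP sHS _ Hh').
  by rewrite conjsgM (normsP nDH).
by move=> g Bg; have [Bgh eqg] := stH _ _ Hh' Bg; rewrite conjgM eqB.
Qed.

Lemma lcoset_act_fix h x (R : {group gT}) :
  (lcoset_act (x *: R) h == x *: R) = (h ^ x \in R).
Proof.
rewrite /= -lcosetM; apply/eqP/idP=> [eqx | Rhx].
  have: h^-1 * x \in x *: R by rewrite -eqx lcoset_refl.
  by rewrite mem_lcoset -groupV !invMg !invgK conjgE mulgA.
apply/lcoset_eqP; rewrite mem_lcoset -groupV !invMg !invgK.
by move: Rhx; rewrite conjgE mulgA.
Qed.

(** An element $h$ fixes $xR$ exactly when $h^x \in R$, so being fixed by $H$ enlarges the condition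
    $P^x \le R$ to $\langle P, H\rangle^x \le R$. *)
Lemma mark_cosets_fix q P B al H :
    char_pair q -> B \subset P -> H \subset S ->
  'Fix_(mark_cosets q P B al | lcoset_act)(H) = mark_cosets q (P <*> H) B al.
Proof.
move=> qP sBP sHS; have sBPH := subset_trans sBP (joing_subl P H).
apply/setP=> C; apply/setIP/idP=> [[/imsetP[x Mx ->] fixH] | /imsetP[x Mx ->]].
  rewrite mem_mark_cosets //; have [Sx sPR eqB] := mark_setP _ _ _ _ _ Mx.
  apply/mark_setP; split=> //; rewrite sub_conjg join_subG -!sub_conjg sPR.
  apply/subsetP=> h Hhx; move/afixP: fixH => /(_ (h ^ x^-1)).
  rewrite -mem_conjg => /(_ Hhx) /eqP.
  by rewrite lcoset_act_fix conjgKV.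
have [Sx] := mark_setP _ _ _ _ _ Mx.
rewrite sub_conjg join_subG -!sub_conjg => /andP[sPR sHR] eqB.
split; first by apply: imset_f; apply/mark_setP.
apply/afixP=> h Hh; apply/eqP; rewrite lcoset_act_fix.
by apply: (subsetP sHR); rewrite memJ_conjg.
Qed.

(** Cauchy-Frobenius for $H$ acting on the cosets counted by [mark q P B al]: the sum is $|H|$ times
    the number of orbits. *)
Lemma dvdn_sum_mark q P B al H :
    char_pair q -> B \subset P -> H \subset S -> H \subset 'N(P) ->
    stabilizes H B al ->
  #|H| %| \sum_(h in H) mark q (P <*> <[h]>) B al.
Proof.
move=> qP sBP sHS nPH stH.
have actH := acts_mark_cosets qP sBP sHS nPH stH.
have markE h : h \in H -> mark q (P <*> <[h]>) B al
    = #|'Fix_(mark_cosets q P B al | lcoset_act)[h]|.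
  move=> Hh; rewrite /mark -mark_cosets_fix ?cycle_subG ?(subsetP sHS) //.
  by rewrite afix_cycle ?inE.
by rewrite (eq_bigr _ markE) (Frobenius_Cauchy actH) dvdn_mull.
Qed.

Lemma mark_pgroup_mod (p : nat) q P B al H :
    char_pair q -> B \subset P -> H \subset S -> H \subset 'N(P) ->
    stabilizes H B al -> p.-group H ->
  mark q P B al = mark q (P <*> H) B al %[mod p].
Proof.
move=> qP sBP sHS nPH stH pH; rewrite /mark -mark_cosets_fix //.
exact: pgroup_fix_mod pH (acts_mark_cosets qP sBP sHS nPH stH).
Qed.

(** A normal form: the value 1 outside [D] makes each function on [D] be represented exactly once,
    so that functions on [D] can be summed over and counted. *)
Definition restr_ffun D (al : gT -> aT) : {ffun gT -> aT} :=
  [ffun g => if g \in D then al g else 1].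

Definition extensions D B al : {set {ffun gT -> aT}} :=
  [set be : {ffun gT -> aT} | (be == restr_ffun D be)
     && [forall g in B, be g == al g]].

Lemma extensionsP D B al (be : {ffun gT -> aT}) :
  reflect (be = restr_ffun D be /\ {in B, be =1 al}) (be \in extensions D B al).
Proof.
rewrite inE; apply: (iffP andP) => -[eqD eqB]; split=> //; first exact/eqP.
- by move=> g Bg; apply/eqP; apply: (forall_inP eqB).
- exact/eqP.
by apply/forall_inP=> g Bg; apply/eqP; apply: eqB.
Qed.

Lemma mark_extensions q D B al :
    char_pair q -> B \subset D ->
  mark q D B al = (\sum_(be in extensions D B al) mark q D D be)%N.
Proof.
move=> qP sBD.
(* [r x] is the stabilizer character at the coset $xR$, restricted to [D]. Since [A] is abelian it
   depends only on the coset, so the cosets can be sorted by it. *)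
pose r x := restr_ffun D (fun g => q.2 (g ^ x)).
have rE x k : D :^ x \subset q.1 -> k \in q.1 -> r (x * k) = r x.
  move=> sDR Rk; apply/ffunP=> g; rewrite !ffunE; case: ifP => // Dg.
  by rewrite conjgM char_pairJ //; apply: (subsetP sDR); rewrite memJ_conjg.
have reprE x : D :^ x \subset q.1 -> r (repr (x *: q.1)) = r x.
  by move=> sDR; have /lcosetP[k Rk ->] := mem_repr x (lcoset_refl q.1 x); apply: rE.
rewrite {1}/mark -sum1_card.
rewrite (partition_big (fun C => r (repr C)) (mem (extensions D B al))) /=; last first.
  move=> _ /imsetP[x /mark_setP[Sx sDR eqB] ->]; rewrite reprE //.
  apply/extensionsP; split; first by apply/ffunP=> g; rewrite !ffunE; case: ifP.
  by move=> g Bg; rewrite ffunE (subsetP sBD) ?eqB.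
apply: eq_bigr => be /extensionsP[beD beB].
rewrite sum1dep_card /mark; apply: eq_card => C; rewrite inE /=.
apply/andP/imsetP=> [[/imsetP[x /mark_setP[Sx sDR eqB] ->]] | [x]].
  rewrite reprE // => /eqP <-; exists x => //; apply/mark_setP; split=> //.
  by move=> g Dg; rewrite ffunE Dg.
move=> /mark_setP[Sx sDR eqD] ->; split.
  apply: imset_f; apply/mark_setP; split=> // g Bg.
  by rewrite eqD ?beB ?(subsetP sBD).
rewrite reprE // beD; apply/eqP/ffunP=> g; rewrite !ffunE.
by case: ifP => // Dg; rewrite eqD.
Qed.

End CosetMarks.

(** * Receptive pairs *)

Section ReceptivePairs.

Variables (gT aT : finGroupType) (S : {group gT}) (F : fusion_system S).
Implicit Types (P Q : {group gT}) (f g : {ffun gT -> gT}) (al : gT -> aT).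

Lemma group_set_AutF P : P \subset S -> group_set (AutF F P).
Proof.
move=> sPS; apply/group_setP; split=> [|a b].
  apply/setIdP; split; first exact: group1.
  apply: fs_ext (HomF_id F (subxx P) sPS) => // x _.
  by rewrite !ffunE perm1.
case/setIdP=> Aa Fa /setIdP[Ab Fb]; apply/setIdP; split; first exact: groupM.
apply: fs_ext (fs_comp sPS sPS sPS Fa Fb) => // x _.
by rewrite !ffunE permM.
Qed.

Definition AutF_stab P al : {set {perm gT}} :=
  [set a in AutF F P | [forall x in P, al (a x) == al x]].

Lemma AutF_stabP P al a :
  reflect (a \in AutF F P /\ {in P, forall x, al (a x) = al x})
          (a \in AutF_stab P al).
Proof.
apply: (iffP setIdP) => -[Fa eqa]; split=> //.
  by move=> x Px; apply/eqP; apply: (forall_inP eqa).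
by apply/forall_inP=> x Px; rewrite eqa.
Qed.

Lemma AutF_closed P a x : a \in AutF F P -> x \in P -> a x \in P.
Proof. by case/setIdP=> Aa _; apply: Aut_closed. Qed.

Lemma group_set_AutF_stab P al : P \subset S -> group_set (AutF_stab P al).
Proof.
move=> sPS; have /group_setP[F1 FM] := group_set_AutF sPS.
apply/group_setP; split=> [|a b].
  by apply/AutF_stabP; split=> // x _; rewrite perm1.
case/AutF_stabP=> Fa eqa /AutF_stabP[Fb eqb].
apply/AutF_stabP; split=> [|x Px]; first exact: FM.
by rewrite permM eqb ?eqa // AutF_closed.
Qed.

Lemma fully_normalized_conjugate P : P \subset S ->
  exists2 f, f \in HomF F P S
    & exists2 Q : {group gT}, f @: P = Q & fully_normalized F Q.
Proof.
move=> sPS; have F1 := HomF_id F sPS (subxx S).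
have [f Ff maxf] := arg_maxnP (fun f : {ffun gT -> gT} => #|'N_S(f @: P)|) F1.
have [Q [sQS defQ _ _]] := HomF_inv sPS Ff.
exists f => //; exists Q => //; apply/forall_inP=> g Fg.
have := maxf _ (HomF_trans sPS Ff defQ Fg).
rewrite -defQ -imset_comp.
by rewrite (eq_imset _ (ffunE (fun x => g (f x)))).
Qed.

Variables (p : nat).
Hypotheses (pS : p.-group S) (satF : saturated F p).

(* Full normalization relative to K = AutF_stab Q al, in the sense of Puig's  *)
(* fully K-normalized subgroups.                                              *)
Definition receptive Q al : bool :=
  [&& Q \subset S, fully_centralized F Q &
    [exists R : {group {perm gT}},
       p.-Sylow(AutF_stab Q al) R && (R \subset AutS S Q)]].

Lemma receptiveP Q al :
  reflect [/\ Q \subset S, fully_centralized F Q &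
    exists2 R : {group {perm gT}}, p.-Sylow(AutF_stab Q al) R & R \subset AutS S Q]
    (receptive Q al).
Proof.
apply: (iffP and3P) => -[sQS cQ sylQ]; split=> //.
  by have [R /andP[sylR sRQ]] := existsP sylQ; exists R.
by have [R sylR sRQ] := sylQ; apply/existsP; exists R; rewrite sylR.
Qed.

(** Move $P$ to a fully normalized $Q$. There $\mathrm{Aut}_S(Q)$ is Sylow in
    $\mathrm{Aut}_{\mathcal{F}}(Q)$, so an automorphism of $Q$ in $\mathcal{F}$ can bring a Sylow
    subgroup of the character's stabilizer inside it. The character is moved along. *)
Lemma receptive_conjugate P al : P \subset S ->
  exists2 f, f \in HomF F P S &
  exists Q be, [/\ f @: P = Q, {in P, forall x, be (f x) = al x} & receptive Q be].
Proof.
move=> sPS; have [f Ff [Q defQ nQ]] := fully_normalized_conjugate sPS.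
have [Q' [sQS defQ' FfQ [g [Fg fK gK]]]] := HomF_inv sPS Ff.
have eqQ : Q' = Q by apply/val_inj; rewrite /= -defQ.
rewrite eqQ in sQS FfQ Fg gK.
have [cQ sylQ] := satF.1 Q sQS nQ.
pose al1 x := al (g x).
pose AF := Group (group_set_AutF sQS).
pose K1 := Group (group_set_AutF_stab al1 sQS).
have sK1AF : K1 \subset AF by apply/subsetP=> a /AutF_stabP[].
have [R sylR] := Sylow_exists p K1.
have sylQ' : p.-Sylow(AF) (AutS S Q) by [].
have sRAF : R \subset AF := subset_trans (pHall_sub sylR) sK1AF.
(* Following [f] by the inverse of [b] replaces [R] by a conjugate inside $\mathrm{Aut}_S(Q)$. *)
have [b Fb sRb] := Sylow_subJ sylQ' sRAF (pHall_pgroup sylR).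
have Fb' : b^-1 \in AF by rewrite groupV.
have Qb x : x \in Q -> b^-1 x \in Q by apply: AutF_closed Fb'.
have fQ x : x \in P -> f x \in Q by move=> Px; rewrite -defQ imset_f.
have Fbf : [ffun x => b^-1 (f x)] \in HomF F P Q.
  have /setIdP[_ FbQ] := Fb'; apply: fs_ext (fs_comp sPS sQS sQS FfQ FbQ) => //.
  by move=> x _; rewrite !ffunE.
exists [ffun x => b^-1 (f x)]; first exact: HomF_widen Fbf.
exists Q, (fun x => al1 (b x)); split.
- apply/eqP; rewrite eqEcard; have [_ injbf sbQ] := fs_inj sPS sQS Fbf.
  rewrite sbQ /=.
  rewrite card_in_imset // -defQ card_in_imset //.
  by have [] := fs_inj sPS (subxx S) Ff.
- by move=> x Px; rewrite ffunE permKV /al1 fK.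
apply/receptiveP; split=> //; exists (R :^ b^-1)%G; last by rewrite sub_conjgV.
have -> : AutF_stab Q (fun x => al1 (b x)) = K1 :^ b^-1.
  apply/setP=> a; rewrite mem_conjgV.
  have bQ x : x \in Q -> b x \in Q by apply: AutF_closed Fb.
  apply/AutF_stabP/AutF_stabP=> -[Fa eqa]; split.
  - by rewrite (groupJ (G := AF)).
  - by move=> x Qx; rewrite conjgE !permM -{2}[x](permKV b) eqa ?permKV // Qb.
  - by rewrite -(groupJr (G := AF) _ Fb).
  by move=> x Qx; have := eqa _ (bQ _ Qx); rewrite conjgE !permM permK.
exact: etrans (pHallJ2 p K1 R b^-1) sylR.
Qed.

(** Through [f], $N$ acts on $Q$ as a $p$-group of automorphisms fixing [be]. Sylow's theorem in the
    stabilizer of [be] moves it into $\mathrm{Aut}_S(Q)$, after which the extension axiom applies.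
    Hence [g] extends [f] only up to an automorphism fixing [be]. *)
Lemma receptive_extend Q be P al f (N : {group gT}) :
    receptive Q be -> P \subset S -> f \in HomF F P S -> f @: P = Q ->
    {in P, forall x, be (f x) = al x} ->
    N \subset 'N_S(P) -> {in N & P, forall h x, al (x ^ h) = al x} ->
  exists2 g, g \in HomF F N S
    & g @: P = Q /\ {in P, forall x, be (g x) = al x}.
Proof.
case/receptiveP=> sQS cQ [R sylR sRQ] sPS Ff defQ eqf sNNP stN.
have [sNS nPN] : N \subset S /\ N \subset 'N(P) by apply/andP; rewrite -subsetI.
have [Q' [_ defQ' FfQ [g [Fg fK gK]]]] := HomF_inv sPS Ff.
have eqQ : Q' = Q by apply/val_inj; rewrite /= -defQ.
rewrite eqQ in FfQ Fg gK.
have [h injh hE] := HomF_morphism sPS Ff.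
have defhQ : h @* P = Q.
  by rewrite -defQ morphimEdom; apply: eq_imset => x; rewrite hE.
pose phi := Aut_isom injh (subxx P).
have phiE n x : n \in N -> x \in P -> phi (conj_aut P n) (f x) = f (x ^ n).
  move=> Nn Px; rewrite -!hE Aut_isomE ?norm_conj_autE ?(subsetP nPN) //.
  exact: Aut_aut.
pose H := (phi @* (conj_aut P @* N))%G.
pose K := Group (group_set_AutF_stab be sQS).
have fP x : x \in P -> f x \in Q by move=> Px; rewrite -defQ imset_f.
have sHK : H \subset K.
  apply/subsetP=> _ /morphimP[_ _ /morphimP[n nPn Nn ->] ->].
  apply/AutF_stabP; split=> [|y]; last first.
    rewrite -defQ => /imsetP[x Px ->].
    by rewrite phiE // !eqf ?stN ?memJ_norm // (subsetP nPN).
  apply/setIdP; split; first by rewrite -{1}defhQ Aut_Aut_isom.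
  have sPnP : P :^ n \subset P by rewrite (normsP nPN).
  have Fc := fs_conj F sPS sPS (subsetP sNS n Nn) sPnP.
  apply: fs_ext (fs_comp sQS sPS sQS Fg (fs_comp sPS sPS sQS Fc FfQ)) => //.
  move=> y; rewrite -defQ => /imsetP[x Px ->]; rewrite !ffunE fK //.
  by rewrite -phiE.
have pH : p.-group H by rewrite !morphim_pgroup // (pgroupS sNS).
(* Correcting [f] by the inverse of [k], which lies in the stabilizer [K], keeps the compatibility
   of [be] with [al]. *)
have [k Kk sHRk] := Sylow_subJ (sylR : p.-Sylow(K) R) sHK pH.
have /AutF_stabP[Fk eqk] : k^-1 \in K by rewrite groupV.
have FkfQ : [ffun x => k^-1 (f x)] \in HomF F P Q.
  have /setIdP[_ FkQ] := Fk; apply: fs_ext (fs_comp sPS sQS sQS FfQ FkQ) => //.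
  by move=> x _; rewrite !ffunE.
set f' := [ffun x => k^-1 (f x)] in FkfQ.
have Ff' : f' \in HomF F P S by apply: HomF_widen FkfQ.
have deff'Q : f' @: P = Q.
  apply/eqP; rewrite eqEcard; have [_ injkf skQ] := fs_inj sPS sQS FkfQ.
  rewrite skQ /=.
  rewrite card_in_imset // -defQ card_in_imset //.
  by have [] := fs_inj sPS (subxx S) Ff.
have eqf' : {in P, forall x, be (f' x) = al x}.
  by move=> x Px; rewrite ffunE eqk ?fP ?eqf.
have sNNf : N \subset Nphi_group S P f'.
  apply/subsetP=> n Nn; rewrite inE (subsetP sNNP) //= deff'Q.
  have Hn : phi (conj_aut P n) \in H.
    have NPn := subsetP nPN n Nn.
    by apply: mem_morphim; [exact: Aut_aut | exact: mem_morphim].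
  have : phi (conj_aut P n) ^ k^-1 \in AutS S Q.
    by rewrite (subsetP sRQ) // -mem_conjg (subsetP sHRk).
  case/morphimP=> m nQm NQm eqm; apply/exists_inP; exists m => //.
  apply/forall_inP=> x Px; have Qx : f' x \in Q by rewrite -deff'Q imset_f.
  rewrite -(norm_conj_autE nQm Qx).
  by rewrite -eqm [phi _ ^ _]conjgE invgK !permM !ffunE permKV phiE.
have sNfS : Nphi_group S P f' \subset S.
  by apply/subsetP=> n /setIdP[/setIP[]].
have [c Fc eqc] := satF.2 P Q f' sPS Ff' deff'Q cQ.
exists c; first exact: HomF_restr Fc.
split; last by move=> x Px; rewrite eqc ?eqf'.
by rewrite -deff'Q; apply: eq_in_imset.
Qed.

End ReceptivePairs.

Import GRing.Theory Num.Theory.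

(** * Stable combinations *)

Section StableCombinations.

Variables (gT aT : finGroupType) (S : {group gT}) (F : fusion_system S).
Variables (A : {group aT}) (gam : gT -> aT) (p : nat).
Hypotheses (abA : abelian A) (gamM : {in S &, {morph gam : x y / x * y}}).
Hypothesis gamA : {in S, forall x, gam x \in A}.
Hypotheses (pS : p.-group S) (satF : saturated F p).

Notation pairT := ({group gT} * {ffun gT -> aT})%type.
Implicit Types (P Q : {group gT}) (B D : {set gT}) (q : pairT).
Implicit Types (f g : {ffun gT -> gT}) (al be : gT -> aT) (c : pairT -> int).

Definition F_pair q : bool :=
  (q.1 \subset S) &&
  [exists f in HomF F q.1 S, [forall x in q.1, q.2 x == gam (f x)]].

Lemma F_pairP q :
  reflect (q.1 \subset S /\
     exists2 f, f \in HomF F q.1 S & {in q.1, forall x, q.2 x = gam (f x)})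
    (F_pair q).
Proof.
apply: (iffP andP) => -[sQS defq]; split=> //.
  have [f Ff /forall_inP eqf] := exists_inP defq; exists f => // x Px.
  by rewrite (eqP (eqf x Px)).
have [f Ff eqf] := defq; apply/exists_inP; exists f => //.
by apply/forall_inP=> x Px; rewrite eqf.
Qed.

Lemma F_pair_char q : F_pair q -> char_pair S A q.
Proof.
case/F_pairP=> sRS [f Ff eqf]; have [fM _ _] := fs_inj sRS (subxx S) Ff.
have fS x : x \in q.1 -> f x \in S by apply: HomF_mem Ff.
split=> // [x y Rx Ry | x Rx]; last by rewrite eqf ?gamA ?fS.
by rewrite !eqf ?groupM // fM // gamM ?fS.
Qed.

Local Open Scope ring_scope.

Definition markZ c D B al : int := \sum_q c q * (mark S q D B al)%:Z.

Definition supported c := forall q, c q != 0 -> F_pair q.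

Definition stable_at c P := forall f al be, f \in HomF F P S ->
    {in P, forall x, be (f x) = al x} ->
  markZ c (f @: P) (f @: P) be = markZ c P P al.

Lemma eq_mark q D B al be : {in B, al =1 be} -> mark S q D B al = mark S q D B be.
Proof.
move=> eqB; rewrite /mark /mark_cosets; congr #|_ @: (_ : {set _})|.
apply/setP=> x; apply/mark_setP/mark_setP=> -[Sx sDR eqx]; split=> // g Bg.
  by rewrite eqx ?eqB.
by rewrite eqx // eqB.
Qed.

Lemma eq_markZ c D B al be : {in B, al =1 be} -> markZ c D B al = markZ c D B be.
Proof. by move=> eqB; apply: eq_bigr => q _; rewrite (eq_mark _ _ eqB). Qed.

Lemma eq_sum_supported c (u v : pairT -> int) :
    supported c -> (forall q, F_pair q -> u q = v q) ->
  \sum_q c q * u q = \sum_q c q * v q.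
Proof.
move=> suppc equv; apply: eq_bigr => q _; have [-> | /suppc Eq] := eqVneq (c q) 0.
  by rewrite !mul0r.
by rewrite equv.
Qed.

Lemma markZ_extensions c D B al : supported c -> B \subset D ->
  markZ c D B al = \sum_(be in extensions D B al) markZ c D D be.
Proof.
move=> suppc sBD; rewrite exchange_big /= /markZ.
under [RHS]eq_bigr => q _ do rewrite -mulr_sumr.
apply: eq_sum_supported => // q Eq.
rewrite (mark_extensions abA al (F_pair_char Eq) sBD) -natz natr_sum.
by apply: eq_bigr => be _; rewrite natz.
Qed.

(** A character prescribed only on [B] is a disjoint union over its extensions to [P]. The map [f]
    matches these with the extensions to the image, and stability applies to each. *)
Lemma stable_sub c P B f al be :
    supported c -> P \subset S -> f \in HomF F P S -> stable_at c P ->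
    B \subset P -> {in B, forall x, be (f x) = al x} ->
  markZ c (f @: P) (f @: B) be = markZ c P B al.
Proof.
move=> suppc sPS Ff stP sBP eqB.
have [Q [sQS defQ FfQ [g [Fg fK gK]]]] := HomF_inv sPS Ff.
rewrite !markZ_extensions ?imsetS //.
pose push (a : {ffun gT -> aT}) := restr_ffun (f @: P) (a \o g).
pose pull (b : {ffun gT -> aT}) := restr_ffun P (b \o f).
have pushE a x : x \in P -> push a (f x) = a x.
  by move=> Px; rewrite ffunE imset_f //= fK.
rewrite (reindex_onto push pull) => [|b /extensionsP[bD _]]; last first.
  apply/ffunP=> y; rewrite ffunE; case: ifP => [Qy | nQy].
    have [x Px ->] := imsetP Qy; rewrite /= fK // ffunE Px //.
  by rewrite bD ffunE nQy.
apply: eq_big => [a | a _]; last by apply: stP => // x Px; rewrite pushE.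
apply/andP/extensionsP=> [[/extensionsP[_ eqa] /eqP pa] | [aD eqa]]; split.
- apply/ffunP=> x; rewrite [RHS]ffunE; case: ifP => // nPx.
  by rewrite -pa ffunE nPx.
- by move=> x Bx; rewrite -eqB // -eqa ?imset_f // pushE ?(subsetP sBP).
- apply/extensionsP; split; first by apply/ffunP=> y; rewrite !ffunE; case: ifP.
  by move=> _ /imsetP[x Bx ->]; rewrite pushE ?(subsetP sBP) // eqa ?eqB.
apply/eqP/ffunP=> x; rewrite ffunE; case: ifP => [Px | nPx].
  by rewrite /= pushE.
by rewrite aD ffunE nPx.
Qed.

Lemma dvdz_sum_markZ c P B al (H : {group gT}) :
    supported c -> B \subset P -> H \subset S -> H \subset 'N(P) ->
    stabilizes H B al ->
  (#|H| %| \sum_(h in H) markZ c (P <*> <[h]>) B al)%Z.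
Proof.
move=> suppc sBP sHS nPH stH; rewrite exchange_big /=.
apply: rpred_sum => q _; rewrite -mulr_sumr.
have [-> | /suppc/F_pair_char qP] := eqVneq (c q) 0; first by rewrite mul0r dvdz0.
apply: dvdz_mull; have := dvdn_sum_mark abA qP sBP sHS nPH stH.
rewrite (_ : \sum_(h in H) _ = (\sum_(h in H) mark S q (P <*> <[h]>) B al)%N%:Z) //.
by rewrite -natz natr_sum; apply: eq_bigr => h _; rewrite natz.
Qed.

(** These are the elements of $S$ normalizing [q.1] and fixing the character [q.2]. By
    [card_mark_set] the order of this group is the mark of [q] at itself times [#|q.1|]. *)
Lemma group_set_stabilizer q : group_set (mark_set S q q.1 q.1 q.2).
Proof.
apply/group_setP; split=> [|x y /mark_setP[Sx sPx eqx] /mark_setP[Sy sPy eqy]].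
  by apply/mark_setP; split; rewrite ?conjsg1 // => g _; rewrite conjg1.
apply/mark_setP; split; first exact: groupM.
  by rewrite conjsgM (subset_trans _ sPy) // conjSg.
by move=> g Pg; rewrite conjgM eqy ?eqx // (subsetP sPx) ?memJ_conjg.
Qed.

(* The table-of-marks congruences for (P, al) and (Q, be), transported along  *)
(* an extension of f to the stabilizer N of (P, al), agree except in the      *)
(* terms indexed by P itself.                                                 *)
Lemma markZ_receptive_mod c q Q be f :
    supported c -> F_pair q -> f \in HomF F q.1 S -> f @: q.1 = Q ->
    {in q.1, forall x, be (f x) = q.2 x} -> receptive F p Q be ->
    (forall P, P \subset S -> (#|q.1| < #|P|)%N -> stable_at c P) ->
  ((mark S q q.1 q.1 q.2)%:Z %| markZ c q.1 q.1 q.2 - markZ c Q Q be)%Z.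
Proof.
move=> suppc Eq Ff defQ eqf recQ stc; have qP := F_pair_char Eq.
set P := q.1 in Ff defQ eqf stc *; set al := q.2 in eqf *.
have sPS : P \subset S by case: qP.
have [N defN] : {N : {group gT} | N = mark_set S q P P al :> {set gT}}.
  by exists (Group (group_set_stabilizer q)).
have sNS : N \subset S by rewrite defN; apply/subsetP=> x /mark_setP[].
have nPN : N \subset 'N(P).
  by rewrite defN; apply/subsetP=> x /mark_setP[_ sPx _]; rewrite inE.
have sPN : P \subset N.
  rewrite defN; apply/subsetP=> x Px; apply/mark_setP.
  split; rewrite ?(subsetP sPS) ?conjGid // => y Py.
  exact: (char_pairJ abA qP).
have stN : {in N & P, forall h x, al (x ^ h)%g = al x}.
  by move=> h x; rewrite defN => /mark_setP[_ _ eqh] Px; apply: eqh.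
have sNNP : N \subset 'N_S(P) by rewrite subsetI sNS.
have [g Fg [gP eqg]] := receptive_extend pS satF recQ sPS Ff defQ eqf sNNP stN.
have [H [sHS defH FgH _]] := HomF_inv sNS Fg.
have [gM ginj _] := fs_inj sNS (subxx S) Fg.
have gJ x h : x \in P -> h \in N -> g (x ^ h)%g = (g x ^ g h)%g.
  by move=> Px Nh; apply: HomF_J Fg _ _ => //; apply: (subsetP sPN).
have nQH : H \subset 'N(Q).
  apply/subsetP=> y; rewrite -defH => /imsetP[h Nh ->]; rewrite inE.
  apply/subsetP=> _ /imsetP[x Qx ->]; move: Qx; rewrite -gP => /imsetP[x' Px' ->].
  by rewrite -gJ // imset_f // memJ_norm // (subsetP nPN).
have stH : stabilizes H Q be.
  move=> y x; rewrite -defH -gP => /imsetP[h Nh ->] /imsetP[x' Px' ->].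
  have Pxh : (x' ^ h)%g \in P by rewrite memJ_norm // (subsetP nPN).
  by rewrite -gJ // imset_f // !eqg ?stN.
have stN' : stabilizes N P al.
  by move=> h x Nh Px; rewrite stN // memJ_norm // (subsetP nPN).
have cardH : #|H| = #|N| by rewrite -defH card_in_imset.
have dvH : (#|N| %| \sum_(h in N) markZ c (Q <*> <[g h]>) Q be)%Z.
  have := dvdz_sum_markZ suppc (subxx Q) sHS nQH stH; rewrite cardH.
  by rewrite -[X in _ -> (_ %| X)%Z](big_imset (fun y => markZ c (Q <*> <[y]>) Q be) ginj) defH.
have dvN := dvdz_sum_markZ suppc (subxx P) sNS nPN stN'.
have := rpredB dvN dvH; rewrite -sumrB.
have joingE h : h \in N -> g @: (P <*> <[h]>) = Q <*> <[g h]>.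
  move=> Nh; have [m injm mE] := HomF_morphism sNS Fg.
  have mI (X : {set gT}) : X \subset N -> g @: X = m @* X.
    by move=> sXN; rewrite morphimEsub //; apply: eq_imset => x; rewrite mE.
  have shN : <[h]> \subset N by rewrite cycle_subG.
  rewrite mI ?join_subG ?sPN // morphimY // morphim_cycle // -mI // gP.
  by rewrite mE.
(* For [h] outside [P] the group $\langle P, h\rangle$ is larger than $P$, where stability is
   already known, so the two sums have equal terms. *)
rewrite (bigID (mem P)) /= [X in _ + X]big1 ?addr0 => [|h /andP[Nh nPh]]; last first.
  apply/eqP; rewrite subr_eq0 -joingE // -gP.
  have sPhN : P <*> <[h]> \subset N by rewrite join_subG sPN cycle_subG.
  have sPhS := subset_trans sPhN sNS.
  rewrite (@stable_sub c (P <*> <[h]>)%G P g al be) ?joing_subl //.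
    exact: HomF_restr Fg.
  apply: stc => //; rewrite proper_card // properE joing_subl join_subG.
  by rewrite cycle_subG (negPf nPh) andbF.
(* For [h] in [P] all terms coincide. So $|N|$ divides $|P|$ times the difference, and cancelling
   $|P|$ leaves the mark of [q] at itself. *)
rewrite (eq_bigr (fun=> markZ c P P al - markZ c Q Q be)) => [|h /andP[Nh Ph]].
  rewrite (eq_bigl (mem P)) => [|h]; last by rewrite andb_idl // => /(subsetP sPN).
  rewrite sumr_const -mulr_natl natz defN (card_mark_set abA al qP (subxx P)).
  by rewrite mulnC PoszM dvdz_mul2l // -lt0n cardG_gt0.
have shP : <[h]> \subset P by rewrite cycle_subG.
by rewrite -joingE // (joing_idPl shP) gP.
Qed.

End StableCombinations.

(** * Correcting the marks at one order of subgroup *)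

Section StableExistence.

Variables (gT aT : finGroupType) (S : {group gT}) (F : fusion_system S).
Variables (A : {group aT}) (gam : gT -> aT) (p : nat).
Hypotheses (abA : abelian A) (gamM : {in S &, {morph gam : x y / x * y}}).
Hypothesis gamA : {in S, forall x, gam x \in A}.
Hypotheses (pS : p.-group S) (satF : saturated F p).

Notation pairT := ({group gT} * {ffun gT -> aT})%type.
Implicit Types (P Q : {group gT}) (B D : {set gT}) (q r : pairT).
Implicit Types (f g : {ffun gT -> gT}) (al be : gT -> aT) (c : pairT -> int).

Definition F_equiv q r : bool :=
  [exists f in HomF F q.1 S,
     (f @: q.1 == r.1) && [forall x in q.1, r.2 (f x) == q.2 x]].

(** Only values on [q.1] are compared, so pairs whose functions differ merely outside the subgroup
    are also identified. *)
Definition S_equiv q r : bool :=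
  [exists s in S, (q.1 :^ s == r.1) && [forall x in q.1, r.2 (x ^ s) == q.2 x]].

Lemma F_equivP q r :
  reflect (exists f, [/\ f \in HomF F q.1 S, f @: q.1 = r.1
             & {in q.1, forall x, r.2 (f x) = q.2 x}]) (F_equiv q r).
Proof.
apply: (iffP exists_inP) => [[f Ff /andP[/eqP defr /forall_inP eqf]] | [f [Ff defr eqf]]].
  by exists f; split=> // x Px; apply/eqP; exact: eqf.
by exists f => //; rewrite defr eqxx; apply/forall_inP=> x Px; rewrite eqf.
Qed.

Lemma S_equivP q r :
  reflect (exists s, [/\ s \in S, q.1 :^ s = r.1
             & {in q.1, forall x, r.2 (x ^ s) = q.2 x}]) (S_equiv q r).
Proof.
apply: (iffP exists_inP) => [[s Ss /andP[/eqP defr /forall_inP eqs]] | [s [Ss defr eqs]]].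
  by exists s; split=> // x Px; apply/eqP; exact: eqs.
by exists s => //; rewrite defr eqxx; apply/forall_inP=> x Px; rewrite eqs.
Qed.

Lemma F_equiv_sub q r : q.1 \subset S -> F_equiv q r -> r.1 \subset S.
Proof.
move=> sqS /F_equivP[f [Ff <- _]].
by apply/subsetP=> _ /imsetP[x qx ->]; exact: HomF_mem Ff qx.
Qed.

Lemma F_equiv_trans q r t :
  q.1 \subset S -> F_equiv q r -> F_equiv r t -> F_equiv q t.
Proof.
move=> sqS /F_equivP[f [Ff defr eqf]] /F_equivP[g [Fg deft eqg]].
have fr x : x \in q.1 -> f x \in r.1 by move=> qx; rewrite -defr imset_f.
apply/F_equivP; exists [ffun x => g (f x)]; split.
- exact: HomF_trans defr Fg.
- by rewrite (eq_imset _ (ffunE (fun x => _))) -deft -defr -imset_comp.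
by move=> x qx; rewrite ffunE eqg ?eqf ?fr.
Qed.

Lemma F_equiv_sym q r : q.1 \subset S -> F_equiv q r -> F_equiv r q.
Proof.
move=> sqS eqqr; have srS := F_equiv_sub sqS eqqr.
have /F_equivP[f [Ff defr eqf]] := eqqr.
have [Q [_ defQ _ [g [Fg fK gK]]]] := HomF_inv sqS Ff.
have eqQ : Q = r.1 by apply/val_inj; rewrite /= -defQ.
rewrite {}eqQ in Fg gK; apply/F_equivP; exists g; split.
- exact: HomF_widen Fg.
- rewrite -defr -imset_comp -[RHS]imset_id; apply: eq_in_imset => x qx.
  by rewrite /= fK.
by move=> y; rewrite -defr => /imsetP[x qx ->]; rewrite fK ?eqf.
Qed.

Lemma S_equiv_F q r : q.1 \subset S -> S_equiv q r -> F_equiv q r.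
Proof.
move=> sqS /S_equivP[s [Ss defr eqs]]; apply/F_equivP.
exists [ffun x => x ^ s]; split.
- by apply: fs_conj => //; rewrite -(conjGid Ss) conjSg.
- by rewrite -defr; apply: eq_imset => x; rewrite ffunE.
by move=> x qx; rewrite ffunE eqs.
Qed.

Lemma S_equiv_refl q : S_equiv q q.
Proof.
apply/S_equivP; exists 1; rewrite group1 conjsg1; split=> // x _.
by rewrite conjg1.
Qed.

Lemma S_equiv_trans q r t : S_equiv q r -> S_equiv r t -> S_equiv q t.
Proof.
case/S_equivP=> s [Ss defr eqs] /S_equivP[s' [Ss' deft eqs']].
apply/S_equivP; exists (s * s'); split; rewrite ?groupM //.
  by rewrite conjsgM defr.
by move=> x qx; rewrite conjgM eqs' ?eqs // -defr memJ_conjg.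
Qed.

Lemma S_equiv_sym q r : S_equiv q r -> S_equiv r q.
Proof.
case/S_equivP=> s [Ss defr eqs]; apply/S_equivP; exists s^-1.
split; rewrite ?groupV //; first by rewrite -defr conjsgK.
by move=> x; rewrite -defr => /imsetP[y qy ->]; rewrite conjgK eqs.
Qed.

Lemma F_pair_equiv q r : F_pair F gam q -> F_equiv q r -> F_pair F gam r.
Proof.
case/F_pairP=> sqS [h Fh eqh] eqqr.
have srS := F_equiv_sub sqS eqqr; apply/F_pairP; split=> //.
have /F_equivP[f [Ff defq eqf]] := F_equiv_sym sqS eqqr.
exists [ffun x => h (f x)]; first exact: HomF_trans defq Fh.
by move=> x rx; rewrite ffunE -eqh ?eqf // -defq imset_f.
Qed.

Lemma mark_neq0 q D B al :
  mark S q D B al != 0%N -> exists x, x \in mark_set S q D B al.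
Proof. by rewrite -lt0n card_gt0 => /set0Pn[_ /imsetP[x Mx _]]; exists x. Qed.

Lemma mark_S_equiv q r t : char_pair S A t -> S_equiv q r ->
  mark S t q.1 q.1 q.2 = mark S t r.1 r.1 r.2.
Proof.
move=> tP /S_equivP[s [Ss defr eqs]]; apply/eqP.
rewrite -(eqn_pmul2r (cardG_gt0 t.1)) -!(card_mark_set abA _ tP) //.
rewrite (_ : mark_set S t q.1 q.1 q.2 = s *: mark_set S t r.1 r.1 r.2).
  by rewrite card_lcoset.
apply/setP=> x; rewrite mem_lcoset.
apply/mark_setP/mark_setP=> -[Sx sqt eqx]; split.
- by rewrite groupM ?groupV.
- by rewrite -defr -conjsgM mulKVg.
- by move=> g; rewrite -defr => /imsetP[k qk ->]; rewrite -conjgM mulKVg eqx ?eqs.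
- by rewrite -(groupMl _ (groupVr Ss)).
- by rewrite -(mulKVg s x) conjsgM defr.
by move=> g qg; rewrite -(mulKVg s x) conjgM eqx ?eqs // -defr memJ_conjg.
Qed.

(** Triangularity of the table of marks: among pairs of equal order, nonzero entries occur only
    within an $S$-class. *)
Lemma mark_S_equiv_neq0 q r :
  #|r.1| = #|q.1| -> mark S r q.1 q.1 q.2 != 0%N -> S_equiv q r.
Proof.
move=> eqcard /mark_neq0[x /mark_setP[Sx sqr eqx]].
apply/S_equivP; exists x; split=> //.
by apply/eqP; rewrite eqEcard sqr cardJg eqcard leqnn.
Qed.

Local Open Scope ring_scope.

Lemma markZ_S_equiv c q r : supported F gam c -> S_equiv q r ->
  markZ S c q.1 q.1 q.2 = markZ S c r.1 r.1 r.2.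
Proof.
move=> suppc eqqr; apply: eq_sum_supported suppc _ => t Et.
by rewrite (mark_S_equiv (F_pair_char gamM gamA Et) eqqr).
Qed.

Lemma markZ_F_pair c D B al : supported F gam c -> markZ S c D B al != 0 ->
  exists q x, [/\ F_pair F gam q, x \in S, D :^ x \subset q.1
                & {in B, forall g : gT, q.2 (g ^ x)%g = al g}].
Proof.
move=> suppc nz; have [q cmq]: exists q, c q * (mark S q D B al)%:Z != 0.
  apply/existsP; apply: contraR nz; rewrite negb_exists => /forallP nz.
  by rewrite /markZ big1 // => q _; apply/eqP; rewrite -[_ == _]negbK nz.
move: cmq; rewrite mulf_eq0 negb_or => /andP[/suppc Eq].
by case/mark_neq0=> x /mark_setP[Sx sDR eqx]; exists q, x.
Qed.

Lemma markZ_neq0 c P al : supported F gam c -> P \subset S ->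
  markZ S c P P al != 0 -> F_pair F gam (P, finfun al).
Proof.
move=> suppc sPS /(markZ_F_pair suppc)[q [x [/F_pairP[sRS [f Ff eqf]] Sx sPR eqx]]].
apply/F_pairP; split=> //=; exists [ffun g => f (g ^ x)%g].
  have := fs_comp sPS sRS (subxx S) (fs_conj F sPS sRS Sx sPR) Ff.
  by apply: fs_ext => // g _; rewrite !ffunE.
by move=> g Pg; rewrite !ffunE -eqx // eqf // (subsetP sPR) ?memJ_conjg.
Qed.

(** The choice depends only on the $\mathcal{F}$-class, since equal predicates have equal picks. The
    default 0 is not reached when [q.1] lies in $S$, by [receptive_conjugate]. *)
Definition target c q : int :=
  if [pick r | F_equiv q r && receptive F p r.1 r.2] is Some r
  then markZ S c r.1 r.1 r.2 else 0.

Definition S_repr q := [pick r | S_equiv q r].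

(* Subtracting this makes the mark at every pair of order n equal to the mark *)
(* at the receptive pair chosen in its F-class; only one pair is adjusted in  *)
(* each S-class.                                                              *)
Definition correction c n q : int :=
  if [&& F_pair F gam q, #|q.1| == n & S_repr q == Some q]
  then ((markZ S c q.1 q.1 q.2 - target c q) %/ (mark S q q.1 q.1 q.2)%:Z)%Z
  else 0.

Lemma target_F_equiv c q r : q.1 \subset S -> F_equiv q r -> target c q = target c r.
Proof.
move=> sqS eqqr; have srS := F_equiv_sub sqS eqqr.
rewrite /target (@eq_pick _ _ (fun t => F_equiv r t && receptive F p t.1 t.2)) // => t.
congr (_ && _); apply/idP/idP; last exact: F_equiv_trans.
by apply: F_equiv_trans => //; apply: F_equiv_sym.
Qed.

Lemma S_repr_equiv q r : S_equiv q r -> S_repr q = S_repr r.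
Proof.
move=> eqqr; apply: eq_pick => t; apply/idP/idP; last exact: S_equiv_trans.
by apply: S_equiv_trans; apply: S_equiv_sym.
Qed.

Lemma dvd_target c q : supported F gam c -> F_pair F gam q ->
    (forall P, P \subset S -> (#|q.1| < #|P|)%N -> stable_at F c P) ->
  ((mark S q q.1 q.1 q.2)%:Z %| markZ S c q.1 q.1 q.2 - target c q)%Z.
Proof.
move=> suppc Eq stc; have [sqS _] := F_pairP _ _ _ Eq.
rewrite /target; case: pickP => [r /andP[/F_equivP[f [Ff defr eqf]] recr] | nor].
  exact: (markZ_receptive_mod abA gamM gamA pS satF suppc Eq Ff defr eqf).
(* The failing branch of the pick is impossible, because the class contains a receptive pair. *)
have [f Ff [Q [be [defQ eqf recQ]]]] := receptive_conjugate satF q.2 sqS.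
case/idP: (nor (Q, finfun be)); apply/andP; split.
  by apply/F_equivP; exists f; split=> // x qx; rewrite ffunE eqf.
move: recQ; rewrite /receptive /=; set K := AutF_stab _ _ _; set K' := AutF_stab _ _ _.
suffices -> : K' = K by [].
by apply/setP=> a; apply/AutF_stabP/AutF_stabP=> -[Fa eqa]; split=> // x Qx;
   have := eqa x Qx; rewrite !ffunE.
Qed.

(** By triangularity only the representative of the $S$-class of [q] contributes, with its mark at
    itself as factor. The division in [correction] is exact by [dvd_target]. *)
Lemma markZ_correction c n q : supported F gam c -> F_pair F gam q -> #|q.1| = n ->
    (forall P, P \subset S -> (n < #|P|)%N -> stable_at F c P) ->
  markZ S (correction c n) q.1 q.1 q.2 = markZ S c q.1 q.1 q.2 - target c q.
Proof.
move=> suppc Eq oq stc; have [sqS _] := F_pairP _ _ _ Eq.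
have [r reprq eqqr] : exists2 r, S_repr q = Some r & S_equiv q r.
  rewrite /S_repr; case: pickP => [r | /(_ q)]; first by exists r.
  by rewrite S_equiv_refl.
have Er := F_pair_equiv Eq (S_equiv_F sqS eqqr).
have or : #|r.1| = n by have /S_equivP[s [_ <- _]] := eqqr; rewrite cardJg.
rewrite {1}/markZ (bigD1 r) //= big1 ?addr0 => [|t ntr]; last first.
  rewrite /correction; case: ifP => [/and3P[Et /eqP ot /eqP reprt]|]; last by rewrite mul0r.
  have [-> | nz] := eqVneq (mark S t q.1 q.1 q.2) 0%N; first by rewrite mulr0.
  have eqqt : S_equiv q t by apply: mark_S_equiv_neq0; rewrite ?ot.
  by case/eqP: ntr; apply/Some_inj; rewrite -reprt -reprq (S_repr_equiv eqqt).
rewrite /correction Er or eqxx -(S_repr_equiv eqqr) reprq eqxx /=.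
rewrite (mark_S_equiv (F_pair_char gamM gamA Er) eqqr) divzK.
  by rewrite (markZ_S_equiv suppc eqqr) (target_F_equiv c sqS (S_equiv_F sqS eqqr)).
by apply: dvd_target => //; rewrite or.
Qed.

(** After the subtraction, marks at order [n] equal [target], a class function. Marks at larger
    subgroups are unchanged, since these have no conjugate inside a subgroup of order [n]. *)
Lemma correction_stable c n : supported F gam c ->
    (forall P, P \subset S -> (n < #|P|)%N -> stable_at F c P) ->
  exists c', [/\ supported F gam c',
    forall P, P \subset S -> (n <= #|P|)%N -> stable_at F c' P
    & forall q, #|q.1| != n -> c' q = c q].
Proof.
move=> suppc stc; pose d := correction c n; exists (fun q => c q - d q).
have markZB D B al : markZ S (fun q => c q - d q) D B al = markZ S c D B al - markZ S d D B al.
  by rewrite /markZ -sumrB; apply: eq_bigr => q _; rewrite mulrBl.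
have suppc' : supported F gam (fun q => c q - d q).
  move=> q; apply: contraR => nEq; rewrite /d /correction (negPf nEq) /= subr0.
  by apply: contraR nEq => /suppc.
split=> // [P sPS le_nP f al be Ff eqf | q nq]; last first.
  by rewrite /d /correction (negPf nq) andbF subr0.
have [Q [sQS defQ _ _]] := HomF_inv sPS Ff.
have cardQ : #|Q| = #|P|.
  by rewrite -defQ card_in_imset //; have [] := fs_inj sPS (subxx S) Ff.
move: le_nP; rewrite leq_eqVlt => /predU1P[eqnP | lt_nP].
  pose q : pairT := (P, finfun al); pose r : pairT := (Q, finfun be).
  have eqqr : F_equiv q r.
    by apply/F_equivP; exists f; split=> // x Px; rewrite !ffunE eqf.
  have alE : {in P, al =1 q.2} by move=> x _; rewrite ffunE.
  have beE : {in Q, be =1 r.2} by move=> x _; rewrite ffunE.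
  rewrite defQ (eq_markZ _ _ _ alE) (eq_markZ _ _ _ beE).
  have [Eq | nEq] := boolP (F_pair F gam q).
    have Er := F_pair_equiv Eq eqqr.
    rewrite !markZB (@markZ_correction _ _ q) // (@markZ_correction _ _ r) ?cardQ //.
    by rewrite !subKr (target_F_equiv c _ eqqr).
  have markZ0 (t : pairT) : t.1 \subset S -> ~~ F_pair F gam t ->
      markZ S (fun q => c q - d q) t.1 t.1 t.2 = 0.
    move=> stS nEt; apply/eqP; apply: contraR nEt => /(markZ_neq0 suppc' stS).
    by case: t stS => [T b] _; rewrite ffunK.
  rewrite (markZ0 r) ?(markZ0 q) //; apply: contra nEq => Er.
  by apply: F_pair_equiv Er _; apply: F_equiv_sym eqqr.
have markZd0 (R : {group gT}) b : (n < #|R|)%N -> markZ S d R R b = 0.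
  move=> lt_nR; rewrite /markZ big1 // => q _; rewrite /d /correction.
  case: ifP => [/and3P[_ /eqP oq _] | _]; last by rewrite mul0r.
  have [-> | /mark_neq0[x /mark_setP[_ sRq _]]] := eqVneq (mark S q R R b) 0%N.
    by rewrite mulr0.
  by have := subset_leq_card sRq; rewrite cardJg oq leqNgt lt_nR.
rewrite defQ !markZB !markZd0 ?cardQ // !subr0 -defQ.
exact: (stc P sPS lt_nP).
Qed.

End StableExistence.

(** * The starting combination at $S$ and the degree modulo $p$ *)

Section StableDegree.

Variables (gT aT : finGroupType) (S : {group gT}) (F : fusion_system S).
Variables (A : {group aT}) (gam : gT -> aT) (p : nat).
Hypotheses (abA : abelian A) (gamM : {in S &, {morph gam : x y / x * y}}).
Hypothesis gamA : {in S, forall x, gam x \in A}.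
Hypotheses (p_pr : prime p) (pS : p.-group S) (satF : saturated F p).

Notation pairT := ({group gT} * {ffun gT -> aT})%type.
Implicit Types (q : pairT) (f : {ffun gT -> gT}) (al : gT -> aT).

Lemma HomF_AutF f : f \in HomF F S S -> exists2 a, a \in AutF F S & {in S, f =1 a}.
Proof.
move=> Ff; have [m injm mE] := HomF_morphism (subxx S) Ff.
have [_ finj sfS] := fs_inj (subxx S) (subxx S) Ff.
have imm : m @* S = S.
  apply/eqP; rewrite eqEcard card_injm // leqnn andbT morphimEdom.
  by rewrite (eq_imset _ mE).
exists (aut injm imm); last by move=> x Sx; rewrite autE ?mE.
apply/setIdP; split; first exact: Aut_aut.
by apply: fs_ext Ff => // x Sx; rewrite ffunE autE ?mE.
Qed.

Definition S_char (a : {perm gT}) : {ffun gT -> aT} := restr_ffun S (gam \o a).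

Definition S_chars : {set {ffun gT -> aT}} := S_char @: AutF F S.

Lemma S_charsP al :
  reflect (exists2 f, f \in HomF F S S & {in S, forall x, al x = gam (f x)})
          (restr_ffun S al \in S_chars).
Proof.
apply: (iffP imsetP) => [[a Fa eqal] | [f Ff eqal]].
  have [_ Ha] := setIdP Fa; exists [ffun x => a x] => // x Sx.
  by have := congr1 (fun u : {ffun gT -> aT} => u x) eqal; rewrite !ffunE Sx.
have [a Fa eqf] := HomF_AutF Ff; exists a => //.
by apply/ffunP=> x; rewrite !ffunE; case: ifP => // Sx; rewrite eqal //= eqf.
Qed.

Lemma gamJ : {in S &, forall x y, gam (x ^ y) = gam x}.
Proof.
move=> x y Sx Sy; apply: (mulgI (gam y)).
rewrite -gamM ?groupJ // -conjgC gamM //.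
exact: (centsP abA _ (gamA Sx) _ (gamA Sy)).
Qed.

Lemma fully_normalized_full : fully_normalized F S.
Proof.
apply/forall_inP=> f _; rewrite (setIidPl (normG S)).
by apply: subset_leq_card; apply: subsetIl.
Qed.

(** The characters form one orbit of $\mathrm{Aut}_{\mathcal{F}}(S)$. The stabilizer of [gam]
    contains the Sylow subgroup $\mathrm{Aut}_S(S)$, because [gam] has abelian target, so its index
    is prime to $p$. *)
Lemma p'card_S_chars : ~~ (p %| #|S_chars|).
Proof.
pose AF := Group (group_set_AutF F (subxx S)).
pose K := Group (group_set_AutF_stab F gam (subxx S)).
have AFV a : a \in AF -> a^-1 \in AF by rewrite groupV.
have AFM a b : a \in AF -> b \in AF -> a * b \in AF by exact: groupM.
have [_ sylS] := satF.1 S (subxx S) fully_normalized_full.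
have sKAF : K \subset AF by apply/subsetP=> a /AutF_stabP[].
have sSK : (AutS S S) \subset K.
  apply/subsetP=> a Sa; apply/AutF_stabP; split=> [|x Sx].
    exact: (subsetP (pHall_sub sylS)).
  have /morphimP[s nSs /setIP[Ss _] ->] := Sa.
  by rewrite norm_conj_autE // gamJ.
have cardAF : #|AF| = (#|S_chars| * #|K|)%N.
  rewrite -sum1_card (partition_big S_char (mem S_chars)) => [|a]; last exact: imset_f.
  rewrite -sum_nat_const; apply: eq_bigr => _ /imsetP[a Fa ->].
  rewrite -(card_lcoset K a) -sum1_card; apply: eq_bigl => b.
  rewrite mem_lcoset; apply/andP/AutF_stabP=> [[Fb /eqP/ffunP eqba] | [Fb eqba]].
    split=> [|x Sx]; first exact: AFM (AFV _ Fa) Fb.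
    have Sx' : a^-1 x \in S by apply: AutF_closed (AFV _ Fa) _.
    by have := eqba (a^-1 x); rewrite !ffunE Sx' /= permM permKV.
  have Fb' : b \in AF.
    by have := AFM _ _ Fa Fb; rewrite mulKVg.
  split=> //; apply/eqP/ffunP=> x; rewrite !ffunE; case: ifP => //= Sx.
  by have := eqba (a x); rewrite permM permK; apply; apply: AutF_closed Fa Sx.
have := Lagrange (pHall_sub sylS : [group of AutS S S] \subset AF).
rewrite cardAF -(Lagrange sSK) mulnCA => /eqP.
rewrite eqn_pmul2l ?cardG_gt0 // => /eqP eqi.
have /and3P[_ _] := sylS; rewrite /= eqi p'natE // => np.
by apply: contra np => /dvdn_mulr->.
Qed.

Local Open Scope ring_scope.

(** Each character $\gamma\circ a$ of $S$, with $a \in \mathrm{Aut}_{\mathcal{F}}(S)$, is taken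
    once. The normal form in [S_chars] prevents repetitions. *)
Let c0 q : int := (q \in setX [set S] S_chars)%:Z.

Lemma c0_supported : supported F gam c0.
Proof.
move=> q; rewrite /c0 inE; case: andP => // -[/set1P qS /imsetP[a Fa eqa]] _.
have [_ Ha] := setIdP Fa; apply/F_pairP; rewrite qS; split=> //.
by exists [ffun x => a x] => // x Sx; rewrite eqa !ffunE Sx.
Qed.

Lemma c0_mark al : markZ S c0 S S al = (restr_ffun S al \in S_chars)%:Z.
Proof.
pose q0 : pairT := (S, restr_ffun S al).
rewrite /markZ (bigD1 q0) //= big1 ?addr0 => [|[R b] neq0]; last first.
  have [-> | nz] := eqVneq (c0 (R, b)) 0; first by rewrite mul0r.
  have bP := F_pair_char gamM gamA (c0_supported nz).
  have [-> | /mark_neq0[x /mark_setP[Sx _ eqx]]] := eqVneq (mark S (R, b) S S al) 0%N.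
    by rewrite mulr0.
  move: nz; rewrite /c0 inE /=; case: andP => // -[/set1P eqR Lb] _.
  case/eqP: neq0; rewrite /q0 eqR; congr (_, _); apply/ffunP=> y.
  case/imsetP: Lb => a Fa eqb; rewrite ffunE; case: ifP => [Sy | nSy].
    by rewrite -eqx //= (char_pairJ abA bP) ?eqR.
  by rewrite eqb ffunE nSy.
rewrite {1}/c0 inE /= inE eqxx; case: (boolP (_ \in _)) => [Lal | //=].
have q0P : char_pair S A q0.
  apply/(F_pair_char gamM gamA)/c0_supported.
  by rewrite /c0 inE /= inE eqxx Lal.
suffices -> : mark S q0 S S al = 1%N by [].
apply/eqP; rewrite -(eqn_pmul2r (cardG_gt0 S)) mul1n.
rewrite -[X in (_ * X)%N]/#|q0.1| -(card_mark_set abA al q0P (subxx S)).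
apply/eqP; congr #|(_ : {set _})|; apply/setP=> x.
apply/mark_setP/idP=> [[] // | Sx]; split=> //; first by rewrite conjGid.
by move=> g Sg; rewrite (char_pairJ abA q0P) //= ffunE Sg.
Qed.

Lemma c0_stable : stable_at F c0 S.
Proof.
move=> f al be Ff eqf; have [a Fa eqa] := HomF_AutF Ff.
have Sa x : x \in S -> a x \in S by apply: AutF_closed Fa.
have fS : f @: S = S.
  apply/eqP; rewrite eqEcard; have [_ finj sfS] := fs_inj (subxx S) (subxx S) Ff.
  by rewrite sfS card_in_imset //=.
have Fa' : (a^-1)%g \in AutF F S.
  by have := groupVr (Fa : a \in Group (group_set_AutF F (subxx S))).
have Sa' x : x \in S -> (a^-1)%g x \in S by apply: AutF_closed Fa'.
rewrite fS !c0_mark; congr (nat_of_bool _)%:Z.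
apply/S_charsP/S_charsP=> -[h Fh eqh].
  exists [ffun x => h (f x)]; first exact: HomF_trans fS Fh.
  by move=> x Sx; rewrite ffunE -eqf // eqh // eqa ?Sa.
have [_ Ha'] := setIdP Fa'.
exists [ffun x => h ((a^-1)%g x)].
  by apply: fs_ext (fs_comp (subxx S) (subxx S) (subxx S) Ha' Fh) => // x _; rewrite !ffunE.
by move=> x Sx; rewrite ffunE -eqh ?Sa' // -eqf ?Sa' // eqa ?Sa' // permKV.
Qed.

Lemma exists_stable_combination : exists c : pairT -> int,
  [/\ supported F gam c, forall P : {group gT}, P \subset S -> stable_at F c P
    & ~~ (p %| \sum_q c q * #|S : q.1|%:Z)%Z].
Proof.
suffices [c [suppc stc eqc]] : exists c : pairT -> int, [/\ supported F gam c,
    forall P : {group gT}, P \subset S -> (#|S| <= #|P| + #|S|)%N -> stable_at F c P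
  & forall q, #|q.1| = #|S| -> c q = c0 q].
  exists c; split=> // [P sPS|]; first by apply: stc; rewrite // leq_addl.
  (* Proper subgroups of $S$ have index divisible by $p$, and at $S$ itself [c] still agrees with
     [c0]. *)
  have eqmod : (p %| \sum_q c q * #|S : q.1|%:Z - \sum_q c0 q)%Z.
    rewrite -sumrB; apply: rpred_sum => q _.
    have [eqS | neqS] := eqVneq q.1 S.
      by rewrite eqc eqS // indexgg mulr1 subrr dvdz0.
    rewrite [c0 q]/c0 inE (negPf (_ : q.1 \notin [set S])) ?inE // subr0.
    have [-> | /suppc/F_pairP[sqS _]] := eqVneq (c q) 0; first by rewrite mul0r dvdz0.
    apply: dvdz_mull; have : p.-nat #|S : q.1| by apply: pnat_dvd pS; apply: dvdn_indexg.
    case/p_natP=> -[|m] eqi; last by rewrite eqi /= expnS [(_ %| _)%Z]dvdn_mulr.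
    case/eqP: neqS; apply/val_inj/eqP; rewrite eqEsubset sqS.
    by rewrite -indexg_eq1 eqi expn0.
  have sumc0 : \sum_q c0 q = #|S_chars|%:Z.
    rewrite -[#|S_chars|]mul1n -(cards1 S) -cardsX -sum1_card -natz natr_sum.
    by rewrite [RHS]big_mkcond; apply: eq_bigr => q _; rewrite /c0; case: ifP.
  apply: contra p'card_S_chars => dvdc.
  by have := rpredB dvdc eqmod; rewrite subKr sumc0.
(* Downward induction on the order of [P], written additively: at stage [k], stability holds for
   orders at least $|S| - k$. At $k = |S|$ the bound is vacuous. *)
elim: {2}#|S| => [|k [c [suppc stc eqc]]].
  exists c0; split=> // [|P sPS]; first exact: c0_supported.
  rewrite addn0 => leSP; suffices -> : P = S by apply: c0_stable.
  by apply/val_inj/eqP; rewrite eqEcard sPS.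
have [leSk | ltkS] := leqP #|S| k.
  by exists c; split=> // P sPS _; apply: stc => //; apply: leq_trans leSk (leq_addl _ _).
have stn (P : {group gT}) : P \subset S -> (#|S| - k.+1 < #|P|)%N -> stable_at F c P.
  by move=> sPS; rewrite subnSK // leq_subLR addnC => /(stc P sPS).
have [c' [suppc' stc' eqc']] := correction_stable abA gamM gamA pS satF suppc stn.
exists c'; split=> // [P sPS leSP | q eqS].
  by apply: stc' => //; rewrite leq_subLR addnC.
rewrite eqc' ?eqc // eqS neq_ltn; apply/orP; right.
by rewrite ltn_subrL cardG_gt0.
Qed.

End StableDegree.

(** * Transfer *)

Import FiniteModule.

Section TransferMarks.

Variables (gT aT : finGroupType) (S : {group gT}) (A : {group aT}).
Hypothesis abA : abelian A.
Implicit Types (R : {group gT}) (q : {group gT} * {ffun gT -> aT}).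

Lemma index_rcoset_conj (B : {group gT}) R x : #|B : R :* x| = #|B : R :^ x|.
Proof.
rewrite /indexg -(card_imset (rcosets (R :^ x) B) (@lcoset_inj _ x)).
congr #|pred_of_set _|; rewrite /rcosets -imset_comp; apply: eq_imset => h /=.
by rewrite !rcosetE conjsgE mulgA -lcosetM mulgV lcoset1.
Qed.

(** The index is the length of the orbit of $Rx$ under $g$, and $g^k$ fixes $Rx$ exactly when this
    length divides $k$. *)
Lemma mem_conj_cycle R g x k :
  ((g ^+ k) ^ x^-1 \in R) = (#|<[g]> : R :* x| %| k).
Proof.
apply/idP/idP=> [Rgk | /dvdnP[m ->]]; last first.
  have := mulg_exp_card_rcosets R g x; rewrite mem_rcoset mulnC expgM.
  by rewrite conjXg conjgE invgK -mulgA => ?; apply: groupX.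
rewrite index_rcoset_conj -indexgI.
have sKg : <[g ^+ k]> \subset <[g]> :&: R :^ x.
  by rewrite cycle_subG inE mem_cycle mem_conjg.
apply: (dvdn_trans (indexgS _ sKg)).
have kg := cycleX g k; have := Lagrange kg; rewrite -!orderE orderXgcd.
have dg := dvdn_gcdl #[g] k; rewrite -[X in _ = X](divnK dg) => /eqP.
rewrite eqn_pmul2l => [/eqP -> | ]; first exact: dvdn_gcdr.
by rewrite divn_gt0 ?gcdn_gt0 ?order_gt0 // dvdn_leq.
Qed.

(* N (k, a) is the number of orbits of g on the cosets of R that have length  *)
(* k and contribute the factor a to the transfer of g.                        *)
Lemma transfer_marks q : char_pair S A q ->
  exists t : gT -> fmod_of abA, {in S &, {morph t : x y / x * y >-> (x + y)%R}} /\
  forall g, g \in S -> exists N : 'I_#|S|.+1 * aT -> nat,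
  [/\ t g = (\sum_j fmod abA j.2 *+ N j)%R,
     forall k a,
       \sum_(j : 'I_#|S|.+1 * aT | (j.1 %| k) && (j.2 ^+ (k %/ j.1) == a)) j.1 * N j
         = mark S q <[g ^+ k]> [set g ^+ k] (fun=> a)
   & forall j, N j != 0 ->
       [/\ 0 < j.1, j.1 %| #[g]
         & exists x, [/\ x \in S, (g ^+ j.1) ^ x \in q.1
                       & q.2 ((g ^+ j.1) ^ x) = j.2]]].
Proof.
move=> qP; have [sRS qM qA] := qP.
pose R := q.1; pose al : {morphism R >-> aT} := Morphism qM.
have sAR : al @* R \subset A by apply/subsetP=> _ /morphimP[x _ Rx ->]; apply: qA.
have abR : abelian (al @* R) := abelianS sAR abA.
(* The transfer of [al] has values in the module of its own image. Moving them to the module of [A]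
   lets transfers of different pairs be added. *)
pose th (u : fmod_of abR) : fmod_of abA := fmod abA (fmval u).
have thM : {morph th : u v / (u + v)%R}.
  by move=> u v; rewrite /th fmvalA fmodM // (subsetP sAR) // fmodP.
have th0 : th 0%R = 0%R by rewrite /th fmval0 fmod1.
exists (fun g => th (transfer S abR g)); split=> [x y Sx Sy | g Sg].
  by rewrite transferM // thM.
pose HG := rcosets R S.
have [X trX] : exists X : {set gT}, is_transversal X (HG :* <[g]>) S.
  by exists (transversal (HG :* <[g]>) S); apply/transversalP/rcosets_cycle_partition.
(* [n x] is the length of the orbit of $Rx$ under $g$, and [v x] is the factor this orbit
   contributes to the transfer. *)
pose n x := #|<[g]> : R :* x|; pose v x := q.2 ((g ^+ n x) ^ x^-1).
have n_gt0 x : 0 < n x by rewrite /n index_rcoset_conj.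
have dvd_n x : n x %| #[g].
  by rewrite /n -mem_conj_cycle expg_order conj1g.
have n_ltS x : n x < #|S|.+1.
  rewrite ltnS (leq_trans (dvdn_leq (order_gt0 g) (dvd_n x))) //.
  by rewrite dvdn_leq ?cardG_gt0 ?order_dvdG.
have Rn x : (g ^+ n x) ^ x^-1 \in R by rewrite mem_conj_cycle.
have sXS : X \subset S := transversal_sub trX.
pose key x : 'I_#|S|.+1 * aT := (inord (n x), v x).
have keyE x : (key x).1 = n x :> nat by rewrite inordK.
exists (fun j => #|[set x in X | key x == j]|); split=> [|k a|j].
- rewrite (transfer_cycle_expansion sRS abR Sg trX).
  rewrite (big_morph th thM th0) (partition_big key xpredT) //=.
  apply: eq_bigr => j _; rewrite -sumr_const; apply: eq_big => [x | x /andP[Xx /eqP <-]].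
    by rewrite inE.
  congr (fmod abA _); apply: (@fmodK _ _ abR (al _)).
  exact: (mem_morphim al (Rn x) (Rn x)).
(* [W y] says that $g^k$ fixes $Ry$ with value [a]. It is constant on $g$-orbits of cosets, so
   counting such cosets amounts to summing orbit lengths. *)
- pose W y := ((g ^+ k) ^ y^-1 \in R) && (q.2 ((g ^+ k) ^ y^-1) == a).
  have Wx x : W x = (n x %| k) && (v x ^+ (k %/ n x) == a).
    rewrite /W mem_conj_cycle; apply: andb_id2l => /divnK dk.
    by rewrite -{1}dk mulnC expgM conjXg (char_pairX _ qP) ?Rn.
  have W_rcoset r x : r \in R -> W (r * x) = W x.
    move=> Rr; rewrite /W invMg conjgM groupJr ?groupV //; apply: andb_id2l => Rx.
    by rewrite (char_pairJ abA qP Rx) ?groupV.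
  have W_cycle x i : W (x * g ^+ i) = W x.
    have gki : (g ^+ k) ^ (g ^+ i)^-1 = g ^+ k.
      by rewrite conjgE invgK mulgA -expgD addnC expgD mulgK.
    by rewrite /W invMg conjgM gki.
  have W_repr x : W (repr (R :* x)) = W x.
    by case: repr_rcosetP => r Rr; apply: W_rcoset.
  have injX : {in X &, injective (fun x => rcosets (R :* x) <[g]>)}.
    move=> x y Xx Xy eqxy; apply: (pblock_inj trX) => //.
    have /andP[/and3P[_ tiX _] _] := trX.
    have HGx : R :* x * <[g]> \in HG :* <[g]>.
      by rewrite mem_mulg ?set11 // -rcosetE imset_f ?(subsetP sXS).
    rewrite !(def_pblock tiX HGx) //.
      have: R :* y \in rcosets (R :* x) <[g]>.
        by rewrite eqxy; apply/rcosetsP; exists 1; rewrite ?group1 ?rcoset1.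
      case/rcosetsP=> h gh eqy; have: y \in R :* x :* h by rewrite -eqy rcoset_refl.
      case/rcosetP=> z Rxz ->; exact: mem_mulg.
    by rewrite -{1}[x]mulg1 mem_mulg ?rcoset_refl.
  transitivity (\sum_(x in X | W x) n x).
    rewrite (partition_big key (fun j => (j.1 %| k) && (j.2 ^+ (k %/ j.1) == a))) /=; last first.
      by move=> x /andP[_]; rewrite Wx inordK.
    apply: eq_bigr => j cj; rewrite mulnC -sum_nat_const.
    apply: eq_big => [x | x]; last by rewrite inE => /andP[_ /eqP <-]; rewrite keyE.
    rewrite inE -andbA; congr (_ && _); apply/idP/andP=> [eqj | [_ //]].
    by split=> //; rewrite Wx; move/eqP: eqj cj => <-; rewrite keyE.
  transitivity (\sum_(C in HG | W (repr C)) 1).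
    have actg : [acts <[g]>, on HG | 'Rs].
      by apply: subset_trans (actsRs_rcosets R S); rewrite cycle_subG.
    rewrite big_mkcondr [RHS]big_mkcondr /= (set_partition_big _ (orbit_partition actg)) /=.
    rewrite -(rcosets_cycle_transversal trX) big_imset //=.
    apply: eq_bigr => x Xx; rewrite (eq_bigr (fun=> nat_of_bool (W x))); last first.
      move=> _ /rcosetsP[_ /cycleP[i ->] ->]; rewrite -rcosetM W_repr W_cycle.
      by case: (W x).
    by rewrite sum_nat_const /n /indexg; case: (W x); rewrite ?muln1 ?muln0.
  (* Transfer uses right cosets and marks use left cosets; inversion exchanges them. *)
  rewrite sum1dep_card /mark -[RHS](card_imset _ (@invg_inj _)).
  apply: eq_card => C; rewrite inE; apply/andP/imsetP.
    case=> /rcosetsP[y Sy ->]; rewrite W_repr => /andP[Ry /eqP vy].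
    exists (y^-1 *: R); last by rewrite invMg invGid invg_set1 invgK.
    apply: imset_f; apply/mark_setP; split; rewrite ?groupV //.
      by rewrite -cycleJ cycle_subG.
    by move=> _ /set1P->.
  case=> _ /imsetP[x /mark_setP[Sx sgR eqa] ->] ->.
  rewrite invMg invGid invg_set1 -rcosetE imset_f ?groupV // rcosetE W_repr /W invgK.
  rewrite eqa ?set11 //; split=> //; rewrite eqxx andbT.
  by apply: (subsetP sgR); rewrite memJ_conjg cycle_id.
rewrite -lt0n card_gt0 => /set0Pn[x]; rewrite inE => /andP[Xx /eqP <-].
rewrite keyE; split=> //; exists x^-1.
by rewrite groupV (subsetP sXS) // Rn.
Qed.

End TransferMarks.

(** * The fusion-invariant combined transfer *)

Section StableTransfer.

Variables (gT aT : finGroupType) (S : {group gT}) (F : fusion_system S).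
Variables (A : {group aT}) (gam : gT -> aT).
Hypotheses (abA : abelian A) (gamM : {in S &, {morph gam : x y / x * y}}).
Hypothesis gamA : {in S, forall x, gam x \in A}.

Notation pairT := ({group gT} * {ffun gT -> aT})%type.
Notation indexT := ('I_#|S|.+1 * aT)%type.
Implicit Types (q : pairT) (j : indexT).

Local Open Scope ring_scope.

(** The system is triangular for divisibility: at $k = d$ the only term of length $d$ is $(d, a)$,
    and all others have smaller length. Length 0 has weight 0, so the sums cannot detect it. *)
Lemma power_sums_inj (N N' : indexT -> int) :
    (forall a, N (ord0, a) = 0) -> (forall a, N' (ord0, a) = 0) ->
    (forall k a,
      \sum_(j : indexT | (j.1 %| k)%N && ((j.2 ^+ (k %/ j.1))%g == a)) j.1%:Z * N j
      = \sum_(j : indexT | (j.1 %| k)%N && ((j.2 ^+ (k %/ j.1))%g == a)) j.1%:Z * N' j) ->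
  N =1 N'.
Proof.
move=> N0 N'0 eqN; suffices IH n : forall j, (j.1 < n)%N -> N j = N' j.
  by move=> j; apply: (IH j.1.+1).
elim: n => // n IHn [d a]; rewrite ltnS leq_eqVlt => /predU1P[/= dn | /IHn //].
have [d0 | d_gt0] := posnP d.
  by rewrite (_ : d = ord0) ?N0 ?N'0 //; apply: val_inj.
have := eqN d a; rewrite (bigD1 (d, a)) /= ?dvdnn ?divnn ?d_gt0 ?expg1 ?eqxx //.
rewrite [RHS](bigD1 (d, a)) /= ?dvdnn ?divnn ?d_gt0 ?expg1 ?eqxx //.
rewrite (eq_bigr (fun j => j.1%:Z * N' j)) => [/addIr|[d' b]] /=.
  by apply: mulfI; rewrite -lt0n.
case/andP=> /andP[dvd eqa] neq; rewrite IHn //= -dn ltn_neqAle dvdn_leq // andbT.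
apply: contra neq => /eqP/val_inj eqd; rewrite eqd xpair_eqE eqxx /=.
by rewrite -(eqP eqa) eqd divnn d_gt0 expg1.
Qed.

Lemma stable_transfer (c : pairT -> int) :
    supported F gam c -> (forall P : {group gT}, P \subset S -> stable_at F c P) ->
  exists t : gT -> fmod_of abA,
  [/\ {in S &, {morph t : x y / (x * y)%g >-> x + y}},
      forall s f, s \in S -> f \in HomF F <[s]>%G S -> t (f s) = t s
    & forall s, s \in S -> exists N : indexT -> int,
      [/\ t s = \sum_j fmod abA j.2 *~ N j,
          forall k a, \sum_(j : indexT | (j.1 %| k)%N && ((j.2 ^+ (k %/ j.1))%g == a))
             j.1%:Z * N j = markZ S c <[(s ^+ k)%g]>%g [set (s ^+ k)%g]%g (fun=> a)
        & forall j, N j != 0 ->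
           [/\ (0 < j.1)%N, (j.1 %| #[s])%N
             & exists q x, [/\ F_pair F gam q, x \in S, ((s ^+ j.1) ^ x)%g \in q.1
                           & q.2 ((s ^+ j.1) ^ x)%g = j.2]]]].
Proof.
move=> suppc stc.
(* Transfers are chosen for all pairs at once. Outside [F_pair] the zero map serves, as [c] vanishes
   there. *)
have /fin_all_exists[t tP] q : exists t : gT -> fmod_of abA, F_pair F gam q ->
    {in S &, {morph t : x y / (x * y)%g >-> x + y}} /\
    forall s, s \in S -> exists N : indexT -> nat,
    [/\ t s = \sum_j fmod abA j.2 *+ N j,
        forall k a, (\sum_(j : indexT | (j.1 %| k)%N && ((j.2 ^+ (k %/ j.1))%g == a))
           j.1 * N j)%N = mark S q <[(s ^+ k)%g]> [set (s ^+ k)%g] (fun=> a)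
      & forall j, N j != 0%N -> [/\ (0 < j.1)%N, (j.1 %| #[s])%N
             & exists x, [/\ x \in S, ((s ^+ j.1) ^ x)%g \in q.1
                           & q.2 ((s ^+ j.1) ^ x)%g = j.2]]].
  have [Eq | _] := boolP (F_pair F gam q); last by exists (fun=> 0).
  by have [t tP] := transfer_marks abA (F_pair_char gamM gamA Eq); exists t.
pose tau s := \sum_q t q s *~ c q.
have tauN s : s \in S -> exists N : indexT -> int,
    [/\ tau s = \sum_j fmod abA j.2 *~ N j,
        forall k a, \sum_(j : indexT | (j.1 %| k)%N && ((j.2 ^+ (k %/ j.1))%g == a))
           j.1%:Z * N j = markZ S c <[(s ^+ k)%g]>%g [set (s ^+ k)%g]%g (fun=> a)
      & forall j, N j != 0 ->
         [/\ (0 < j.1)%N, (j.1 %| #[s])%N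
           & exists q x, [/\ F_pair F gam q, x \in S, ((s ^+ j.1) ^ x)%g \in q.1
                         & q.2 ((s ^+ j.1) ^ x)%g = j.2]]].
  move=> Ss; have /fin_all_exists[N NP] q : exists N : indexT -> nat, F_pair F gam q ->
    [/\ t q s = \sum_j fmod abA j.2 *+ N j,
        forall k a, (\sum_(j : indexT | (j.1 %| k)%N && ((j.2 ^+ (k %/ j.1))%g == a))
           j.1 * N j)%N = mark S q <[(s ^+ k)%g]> [set (s ^+ k)%g] (fun=> a)
      & forall j, N j != 0%N -> [/\ (0 < j.1)%N, (j.1 %| #[s])%N
             & exists x, [/\ x \in S, ((s ^+ j.1) ^ x)%g \in q.1
                           & q.2 ((s ^+ j.1) ^ x)%g = j.2]]].
    have [Eq | _] := boolP (F_pair F gam q); last by exists (fun=> 0%N).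
    by have [_ /(_ s Ss)[N NP]] := tP q Eq; exists N.
  exists (fun j => \sum_q c q * (N q j)%:Z); split=> [|k a|j nz].
  - under [RHS]eq_bigr => j _ do rewrite raddf_sum /=.
    rewrite exchange_big /=; apply: eq_bigr => q _.
    have [-> | /suppc Eq] := eqVneq (c q) 0.
      by rewrite mulr0z big1 // => j _; rewrite mul0r mulr0z.
    have [-> _ _] := NP q Eq; rewrite mulrz_suml; apply: eq_bigr => j _.
    by rewrite mulrC mulrzA -pmulrn.
  - under eq_bigr => j _ do rewrite mulr_sumr.
    rewrite exchange_big /=; under eq_bigr => q _.
      under eq_bigr => j _ do rewrite mulrCA -PoszM.
      rewrite -mulr_sumr; over.
    apply: eq_sum_supported suppc _ => q Eq; have [_ <- _] := NP q Eq.
    by rewrite -natz natr_sum; apply: eq_bigr => j _; rewrite natz.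
  have [q cNq]: exists q, c q * (N q j)%:Z != 0.
    apply/existsP; apply: contraR nz; rewrite negb_exists => /forallP nz.
    by rewrite big1 // => q _; apply/eqP; rewrite -[_ == _]negbK nz.
  move: cNq; rewrite mulf_eq0 negb_or => /andP[/suppc Eq Nqj].
  have [_ _ /(_ j Nqj)[j_gt0 dvdj [x [Sx Rx eqx]]]] := NP q Eq.
  by split=> //; exists q, x.
exists tau; split=> // [x y Sx Sy | s f Ss Ff].
  rewrite /tau -big_split; apply: eq_bigr => q _ /=.
  have [-> | /suppc Eq] := eqVneq (c q) 0; first by rewrite !mulr0z addr0.
  by have [tM _] := tP q Eq; rewrite tM // mulrzDl.
have sSs : <[s]>%g \subset S by rewrite cycle_subG.
have Sfs : f s \in S by apply: HomF_mem Ff (cycle_id s).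
have [N [-> NP N0]] := tauN s Ss; have [N' [-> NP' N'0]] := tauN _ Sfs.
have zero0 (M : indexT -> int) : (forall j, M j != 0 -> (0 < j.1)%N) -> forall a, M (ord0, a) = 0.
  by move=> M0 a; apply/eqP; apply/negPn/negP => /M0.
(* The orbit data of [s] and [f s] agree because their powers have equal marks, by stability at the
   cyclic subgroups they generate. *)
suffices eqN : N' =1 N by apply: eq_bigr => j _; rewrite eqN.
apply: power_sums_inj => [||k a].
- by apply: zero0 => j /N'0[].
- by apply: zero0 => j /N0[].
rewrite NP NP'; have [m _ mE] := HomF_morphism sSs Ff.
have fk : f (s ^+ k)%g = (f s ^+ k)%g by rewrite -!mE morphX ?cycle_id.
have sk : <[(s ^+ k)%g]>%g \subset <[s]>%g := cycleX s k.
have fI (X : {set gT}) : X \subset <[s]>%g -> f @: X = (m @* X)%g.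
  by move=> sX; rewrite morphimEsub //; apply: eq_imset => x; rewrite mE.
have -> : <[(f s ^+ k)%g]>%g = f @: <[(s ^+ k)%g]>%g.
  by rewrite fI // morphim_cycle ?mem_cycle // mE fk.
have -> : [set (f s ^+ k)%g]%g = f @: [set (s ^+ k)%g]%g by rewrite imset_set1 fk.
have skS := subset_trans sk sSs.
apply: (stable_sub abA gamM gamA suppc (P := <[(s ^+ k)%g]>%G)) => //.
- exact: HomF_restr Ff.
- exact: stc.
by rewrite sub1set cycle_id.
Qed.

End StableTransfer.

(** * Fully centralized elements *)

Lemma free_enum_coef (K : fieldType) (V : vectType K) (T : finType) (B : {set T})
    (f : T -> V) (k : T -> K) :
    free [seq f x | x <- enum B] -> (\sum_(x in B) k x *: f x)%R = 0%R ->
  {in B, forall x, k x = 0%R}.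
Proof.
move=> freeB sum0 x Bx; pose X := map_tuple f (in_tuple (enum B)).
have xB : x \in enum B by rewrite mem_enum.
have ltx : index x (enum B) < size (enum B) by rewrite index_mem.
have /freeP freeX : free X := freeB.
have := freeX (fun i => k (nth x (enum B) i)) _ (Ordinal ltx).
rewrite /= nth_index //; apply; rewrite -[RHS]sum0 -[RHS]big_enum [RHS](big_nth x) big_mkord.
by apply: eq_bigr => i _; rewrite (nth_map x).
Qed.

Section FusionElements.

Variables (gT : finGroupType) (S : {group gT}) (F : fusion_system S).
Implicit Types (P : {group gT}) (f : {ffun gT -> gT}) (u v : gT).

Lemma FconjugatesP u v :
  reflect (exists2 f, f \in HomF F <[u]>%G S & v = f u) (v \in Fconjugates F u).
Proof. exact: imsetP. Qed.

Lemma HomF_cycle u f : u \in S -> f \in HomF F <[u]>%G S -> f @: <[u]> = <[f u]>.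
Proof.
move=> Su Ff; have sSu : <[u]> \subset S by rewrite cycle_subG.
have [m _ mE] := HomF_morphism (sSu : <[u]>%G \subset S) Ff.
rewrite -mE -morphim_cycle ?cycle_id // morphimEdom.
by apply: eq_imset => x; rewrite mE.
Qed.

Lemma Fconjugates_sub u v : u \in S -> v \in Fconjugates F u -> v \in S.
Proof.
move=> Su /FconjugatesP[f Ff ->].
by apply: HomF_mem Ff (cycle_id u); rewrite cycle_subG.
Qed.

Lemma Fconjugates_trans u v w :
    u \in S -> v \in Fconjugates F u -> w \in Fconjugates F v ->
  w \in Fconjugates F u.
Proof.
move=> Su /FconjugatesP[f Ff ->] /FconjugatesP[g Fg ->]; apply/FconjugatesP.
have sSu : <[u]>%G \subset S by rewrite cycle_subG.
exists [ffun x => g (f x)]; last by rewrite ffunE.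
exact: (HomF_trans sSu Ff (Q := <[f u]>%G) (HomF_cycle Su Ff) Fg).
Qed.

Lemma Fconjugates_order u v : u \in S -> v \in Fconjugates F u -> #[v] = #[u].
Proof.
move=> Su /FconjugatesP[f Ff ->].
have sSu : <[u]>%G \subset S by rewrite cycle_subG.
have [_ finj _] := fs_inj sSu (subxx S) Ff.
by rewrite !orderE -(HomF_cycle Su Ff) card_in_imset.
Qed.

Lemma fully_centralizedP u : u \in S ->
  reflect {in Fconjugates F u, forall v, #|'C_S(<[v]>)| <= #|'C_S(<[u]>)|}
          (fully_centralized F <[u]>%G).
Proof.
move=> Su; apply: (iffP forall_inP) => [fc _ /FconjugatesP[f Ff ->] | fc f Ff].
  by rewrite -HomF_cycle ?fc.
by rewrite HomF_cycle // fc //; apply/FconjugatesP; exists f.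
Qed.

Lemma exists_fully_centralized u : u \in S ->
  exists2 v, v \in Fconjugates F u & fully_centralized F <[v]>%G.
Proof.
move=> Su; have Fu : u \in Fconjugates F u.
  apply/FconjugatesP; exists [ffun x => x]; last by rewrite ffunE.
  by apply: HomF_id; rewrite ?cycle_subG.
have [v Fv maxv] := arg_maxnP (fun v => #|'C_S(<[v]>)|) Fu.
exists v => //; apply/fully_centralizedP; first exact: Fconjugates_sub Fv.
by move=> w Fw; apply: maxv; apply: Fconjugates_trans Fw.
Qed.

End FusionElements.

(* The values of a stable combination at a fully centralized element v are    *)
(* counted modulo p on the cosets fixed by C_S(v); a morphism of F defined on *)
(* a conjugate of C_S(v) sends v to a fully centralized element.              *)
Section FixedCosets.

Variables (gT aT : finGroupType) (S : {group gT}) (F : fusion_system S).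
Variables (A : {group aT}) (gam : gT -> aT) (p : nat).
Hypotheses (abA : abelian A) (gamM : {in S &, {morph gam : x y / x * y}}).
Hypothesis gamA : {in S, forall x, gam x \in A}.
Hypotheses (pS : p.-group S).
Variable c : {group gT} * {ffun gT -> aT} -> int.
Hypothesis suppc : supported F gam c.

Local Open Scope ring_scope.

Lemma markZ_pgroup_mod (P H : {group gT}) (B : {set gT}) (al : gT -> aT) :
    B \subset P -> H \subset S -> H \subset 'N(P) -> stabilizes H B al ->
  (p %| markZ S c P B al - markZ S c (P <*> H) B al)%Z.
Proof.
move=> sBP sHS nPH stH; rewrite -sumrB; apply: rpred_sum => q _; rewrite -mulrBr.
have [-> | /suppc/(F_pair_char gamM gamA) qP] := eqVneq (c q) 0.
  by rewrite mul0r dvdz0.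
apply: dvdz_mull; rewrite -eqz_mod_dvd !modz_nat eqz_nat.
exact/eqP/(mark_pgroup_mod abA qP sBP sHS nPH stH)/(pgroupS sHS).
Qed.

(** An empty [B] imposes no condition on the character, so the right side counts all cosets fixed by
    [v]; the left side sorts them by value. *)
Lemma sum_markZ_values (v : gT) :
  \sum_a markZ S c <[v]> [set v] (fun=> a) = markZ S c <[v]> set0 (fun=> 1%g).
Proof.
rewrite exchange_big /=; under eq_bigr => q _ do rewrite -mulr_sumr.
apply: eq_sum_supported suppc _ => q /(F_pair_char gamM gamA) qP.
rewrite -[RHS]natz; under eq_bigr => a _ do rewrite -natz.
rewrite -natr_sum; congr _%:R.
have sv : [set v] \subset <[v]> by rewrite sub1set cycle_id.
apply/eqP; rewrite -(eqn_pmul2r (cardG_gt0 q.1)) big_distrl /=.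
rewrite -(card_mark_set abA _ qP) ?sub0set // -sum1_card.
rewrite (partition_big (fun x => q.2 (v ^ x)%g) xpredT) //=; apply/eqP.
apply: eq_bigr => a _; rewrite -(card_mark_set abA _ qP) // -sum1_card.
apply: eq_bigl => x; apply/mark_setP/andP=> [[Sx sR eqa] | [/mark_setP[Sx sR _] /eqP eqa]].
  split; last by rewrite eqa ?set11.
  by apply/mark_setP; split=> // g; rewrite inE.
by split=> // g /set1P->.
Qed.

Lemma markZ_degree (al : gT -> aT) :
  markZ S c 1%g set0 al = \sum_q c q * #|S : q.1|%:Z.
Proof.
apply: eq_sum_supported suppc _ => q Eq; have qP := F_pair_char gamM gamA Eq.
have sRS : q.1 \subset S by case: qP.
congr _%:Z; apply/eqP; rewrite -(eqn_pmul2r (cardG_gt0 q.1)).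
rewrite -(card_mark_set abA _ qP) ?sub0set // mulnC Lagrange //; apply/eqP.
congr #|pred_of_set _|; apply/setP=> x; apply/mark_setP/idP=> [[] // | Sx].
by split=> // [|g]; rewrite ?conjs1g ?sub1G // inE.
Qed.

(** A nonzero mark gives a morphism defined on a conjugate of $C_S(v)$. Being injective, it embeds
    that conjugate into $C_S(w)$, so $|C_S(w)|$ is also maximal. *)
Lemma markZ_centralizer_neq0 (v : gT) a : v \in S ->
    fully_centralized F <[v]>%G ->
    markZ S c (<[v]> <*> 'C_S(<[v]>)) [set v] (fun=> a) != 0 ->
  exists w, [/\ w \in Fconjugates F v, fully_centralized F <[w]>%G & gam w = a].
Proof.
move=> Sv fcv /(markZ_F_pair suppc)[q [x [/F_pairP[sRS [f Ff eqf]] Sx sDR eqa]]].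
have [sD1 sD2] : <[v]> :^ x \subset q.1 /\ 'C_S(<[v]>) :^ x \subset q.1.
  by apply/andP; move: sDR; rewrite sub_conjg join_subG -!sub_conjg.
have Rvx : (v ^ x)%g \in q.1 by apply: (subsetP sD1); rewrite memJ_conjg cycle_id.
pose w := f (v ^ x)%g; have Sw : w \in S by apply: HomF_mem Ff Rvx.
have Fw : w \in Fconjugates F v.
  apply/FconjugatesP; exists [ffun g => f (g ^ x)%g]; last by rewrite ffunE.
  have svS : <[v]>%G \subset S by rewrite cycle_subG.
  have := fs_comp svS sRS (subxx S) (fs_conj F svS sRS Sx sD1) Ff.
  by apply: fs_ext => // g _; rewrite !ffunE.
exists w; split=> //; last by rewrite /w -eqf // eqa ?set11.
apply/fully_centralizedP=> // z Fz.
have Fvz : z \in Fconjugates F v by apply: Fconjugates_trans Fz.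
apply: leq_trans (elimT (fully_centralizedP _ Sv) fcv z Fvz) _.
have [fM finj _] := fs_inj sRS (subxx S) Ff.
rewrite -(cardJg _ x) -(card_in_imset (f := f) (sub_in2 (subsetP sD2) finj)).
apply: subset_leq_card; apply/subsetP=> _ /imsetP[y Dy ->].
have Ry : y \in q.1 := subsetP sD2 y Dy.
rewrite inE (HomF_mem sRS Ff Ry) cent_cycle; apply/cent1P.
have [d Cd defy] := imsetP Dy.
have cdv : commute y (v ^ x)%g.
  rewrite defy /commute -!conjMg; congr (_ ^ _)%g.
  by move: Cd; rewrite inE cent_cycle => /andP[_ /cent1P].
by rewrite /w /commute -!fM // cdv.
Qed.

End FixedCosets.

(** * Linear independence and the final contradiction *)

Lemma abelem_prod_expn (p : nat) (rT : finGroupType) (E : {group rT})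
    (abelE : p.-abelem E) (ntE : E :!=: 1) (B : {set rT}) (m : rT -> nat) :
    prime p -> B \subset E -> lin_indep abelE ntE B ->
    \prod_(a in B) a ^+ m a = 1 ->
  {in B, forall a, p %| m a}.
Proof.
move=> p_pr sBE freeB prod1 a Ba.
rewrite (dvdn_pcharf (pchar_Fp p_pr)); apply/eqP.
apply: (free_enum_coef (k := fun a => ((m a)%:R)%R) freeB) Ba.
transitivity (abelem_rV abelE ntE (\prod_(a in B) a ^+ m a)); last first.
  by rewrite prod1 abelem_rV_1.
have mX b : b \in B -> b ^+ m b \in E by move=> Bb; rewrite groupX ?(subsetP sBE).
rewrite (morph_prod (abelem_rV_morphism abelE ntE) _ mX).
apply: eq_bigr => b Bb; rewrite /= abelem_rV_X //; exact: (subsetP sBE).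
Qed.

Theorem mainTheorem1 (p : nat) (gT : finGroupType) (S : {group gT})
    (F : fusion_system S) (T : {group gT}) (u : gT)
    (p_pr : prime p) (pS : p.-group S) (satF : saturated F p)
    (nTS : T <| S) (ltTS : T \proper S) (abST : abelian (S / T))
    (uST : u \in S :\: T)
    (u_min : forall s : gT, s \in S :\: T -> (#[u] <= #[s])%N)
    (indI : lin_indep (Ohm1_quotient_abelem pS abST)
              (Ohm1_quotient_neq1 nTS ltTS)
              (coset T @: [set v in Fconjugates F u |
                            fully_centralized F <[v]>%G & v \in S :\: T])) :
  u \in focal F ->
  exists v : gT, [/\ v \in Fconjugates F u, fully_centralized F <[v]>%G & v \in T].
Proof.
set I := [set v in Fconjugates F u | _ & _] in indI * => foc_u.
have [/setDP[Su nTu] [sTS nTS']] := (uST, andP nTS).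
have [/exists_inP[v Fv /andP[fcv Tv]] | noT] := boolP
  [exists v in Fconjugates F u, fully_centralized F <[v]>%G && (v \in T)].
  by exists v.
have gamM : {in S &, {morph coset T : x y / x * y}}.
  by move=> x y Sx Sy; rewrite morphM ?(subsetP nTS').
have gamA : {in S, forall x, coset T x \in (S / T)%G}.
  by move=> x Sx; apply: mem_quotient.
have lt_u x : x \in S -> #[x] < #[u] -> coset T x = 1.
  move=> Sx ltxu; apply: coset_id; apply: contraLR ltxu => nTx.
  by rewrite -leqNgt u_min // inE nTx.
have u_neq1 : u != 1 by apply: contraNneq nTu => ->.
have ordX x k : x \in S -> #[x] = #[u] -> 1 < k -> k %| #[x] -> #[x ^+ k] < #[u].
  move=> Sx <- k_gt1 dvdk; rewrite orderXdiv // ltn_Pdiv ?order_gt0 //.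
have p_dvd_u x : #[x] = #[u] -> x \in S -> p %| #[x].
  move=> oxu Sx; have sxS : <[x]> \subset S by rewrite cycle_subG.
  have ntx : <[x]>%G :!=: 1 by rewrite /= cycle_eq1 -order_eq1 oxu order_eq1.
  by have [_ dvdp _] := pgroup_pdiv (pgroupS sxS pS) ntx.
have [c [suppc stc degc]] := exists_stable_combination abST gamM gamA p_pr pS satF.
have [t [tM t_inv tN]] := stable_transfer abST gamM gamA suppc stc.
(* An $\mathcal{F}$-invariant homomorphism sends every generator $s^{-1}s^\varphi$ of the focal
   subgroup to 0. *)
have tu : (t u = 0)%R.
  pose tm : {morphism S >-> fmod_of abST} := Morphism tM.
  have sfoc : focal F \subset 'ker tm.
    rewrite gen_subG; apply/subsetP=> _ /imset2P[s f Ss Ff ->].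
    have Sfs : f s \in S by apply: HomF_mem Ff (cycle_id s); rewrite cycle_subG.
    apply/kerP; rewrite ?groupM ?groupV //=.
    by rewrite -[t _]/(tm _) morphM ?groupV // morphV //= t_inv // mulVg.
  by have := mker (subsetP sfoc u foc_u).
have [v Fv fcv] := exists_fully_centralized F Su.
have Sv := Fconjugates_sub Su Fv; have ov := Fconjugates_order Su Fv.
have tv : (t v = 0)%R.
  by have /FconjugatesP[f Ff ->] := Fv; rewrite t_inv.
have [N [tvE NP N0]] := tN v Sv.
pose M a := markZ S c <[v]> [set v] (fun=> a).
pose d1 : 'I_#|S|.+1 := inord 1.
have d1E : d1 = 1%N :> nat by rewrite inordK // ltnS cardG_gt0.
(* At $k = 1$ only orbits of length 1 are counted. *)
have NM a : N (d1, a) = M a.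
  have := NP 1%N a; rewrite !expg1 -/(M a) => <-.
  rewrite (big_pred1 (d1, a)) /= ?d1E ?mul1r // => -[d b].
  rewrite /= dvdn1 xpair_eqE (_ : (d == d1) = (d == 1%N :> nat)); last first.
    by rewrite -d1E.
  by apply: andb_id2l => /eqP ->; rewrite divn1 expg1.
(* An orbit of length $d > 1$ contributes the image of a conjugate of $v^d$. Its order is less than
   $|u|$, so it lies in $T$. *)
have long_orbit j : j.1 != d1 -> (fmod abST j.2 *~ N j = 0)%R.
  move=> j1; have [-> | /N0[j_gt0 dvdj [q [x [/F_pairP[sRS [f Ff eqf]] Sx Rx <-]]]]] :=
    eqVneq (N j) 0%R; first by rewrite mulr0z.
  rewrite eqf // lt_u ?fmod1 ?mul0rz //; first exact: HomF_mem Ff Rx.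
  have [m _ mE] := HomF_morphism sRS Ff; rewrite -mE.
  apply: leq_ltn_trans (dvdn_leq (order_gt0 _) (morph_order m Rx)) _.
  rewrite orderJ ordX // ltn_neqAle j_gt0 andbT eq_sym.
  by apply: contra j1 => /eqP j1; apply/eqP/val_inj; rewrite /= j1 d1E.
have sumM : (\sum_a fmod abST a *~ M a = 0)%R.
  rewrite -[RHS]tv tvE (bigID (fun j => j.1 == d1)) /= [X in (_ + X)%R]big1 ?addr0 //.
  rewrite (reindex_onto (fun a => (d1, a)) snd) /=; last by move=> [d b] /= /eqP->.
  by apply: eq_big => [a | a _]; rewrite ?eqxx // NM.
have expM a : (M a != 0)%R -> a ^+ p = 1 /\ a \in S / T.
  case/(markZ_F_pair suppc)=> q [x [/F_pairP[sRS [f Ff eqf]] Sx sDR eqa]].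
  have Rvx : v ^ x \in q.1 by apply: (subsetP sDR); rewrite memJ_conjg cycle_id.
  have Sw : f (v ^ x) \in S by apply: HomF_mem Ff Rvx.
  rewrite -(eqa v (set11 v)) eqf //; split; last exact: gamA.
  have [m injm mE] := HomF_morphism sRS Ff.
  have ow : #[f (v ^ x)] = #[u] by rewrite -mE order_injm // orderJ.
  rewrite -morphX ?(subsetP nTS') //= lt_u ?groupX // ordX ?prime_gt1 //.
  exact: p_dvd_u.
pose IT := coset T @: I.
have sIT : IT \subset 'Ohm_1(S / T).
  apply/subsetP=> _ /imsetP[w /setIdP[Fw /andP[_ /setDP[Sw _]]] ->].
  have ow := Fconjugates_order Su Fw.
  rewrite (OhmE 1 (quotient_pgroup T pS)) mem_gen // inE mem_quotient //= inE.
  rewrite -morphX ?(subsetP nTS') //= lt_u ?groupX // expn1 ordX ?prime_gt1 //.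
  exact: p_dvd_u.
(* Modulo $p$, only cosets fixed by $C_S(v)$ count. Their values are cosets $wT$ with $w$ a fully
   centralized conjugate, outside $T$ by [noT], hence in $\mathcal{I}T$. *)
have pM a : a \notin IT -> (p %| M a)%Z.
  move=> nITa; have sDS : 'C_S(<[v]>) \subset S := subsetIl _ _.
  have nD : 'C_S(<[v]>) \subset 'N(<[v]>).
    by rewrite subIset // cent_sub orbT.
  have stD : stabilizes 'C_S(<[v]>)%G [set v] (fun=> a).
    move=> h g /setIP[_ /centP cvh] /set1P->; split=> //.
    by rewrite inE conjgE -cvh ?cycle_id // mulKg.
  have sv : [set v] \subset <[v]> by rewrite sub1set cycle_id.
  have := markZ_pgroup_mod abST gamM gamA pS suppc sv sDS nD stD.
  rewrite -/(M a); have [-> | ] := eqVneq (markZ S c (<[v]> <*> 'C_S(<[v]>)) [set v] (fun=> a)) 0%R.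
    by rewrite subr0.
  case/(markZ_centralizer_neq0 suppc Sv fcv) => w [Fvw fcw eqa].
  have Fw := Fconjugates_trans Su Fv Fvw; case/negP: nITa.
  rewrite -eqa imset_f // inE Fw fcw inE (Fconjugates_sub Su Fw) andbT.
  by apply: contra noT => Tw; apply/exists_inP; exists w; rewrite // fcw.
have {}sumM : (\sum_(a in IT) fmod abST a *~ M a = 0)%R.
  rewrite -[RHS]sumM [RHS](bigID (mem IT)) /= [X in (_ + X)%R]big1 ?addr0 //.
  move=> a nITa; have [-> | /expM[ap Aa]] := eqVneq (M a) 0%R; first by rewrite mulr0z.
  have /dvdzP[k ->] := pM a nITa.
  by rewrite mulrC mulrzA -pmulrn -fmodX // ap fmod1 mul0rz.
(* [M a] may be negative. Its least residue gives a natural exponent with the same effect on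
   elements killed by $p$. *)
pose m a := `|(M a %% p)%Z|%N.
have p_gt0 := prime_gt0 p_pr.
have mE a : (M a = (M a %/ p)%Z * p + (m a)%:Z)%R.
  by rewrite /m gez0_abs ?modz_ge0 -?divz_eq // eqz_nat -lt0n.
have dvdm : {in IT, forall a, p %| m a}.
  apply: (abelem_prod_expn p_pr sIT indI).
  have sITA := subset_trans sIT (Ohm_sub 1 (S / T)).
  transitivity (fmval (\sum_(a in IT) fmod abST a *~ M a)%R); last by rewrite sumM fmval0.
  rewrite fmval_sum; apply: eq_bigr => a ITa; have Aa := subsetP sITA a ITa.
  have ap : a ^+ p = 1.
    have /abelemP := Ohm1_quotient_abelem pS abST.
    by case=> // _; apply; apply: (subsetP sIT).
  rewrite {1}mE mulrzDr mulrC mulrzA -!pmulrn -fmodX // ap fmod1 mul0rz add0r.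
  by rewrite -fmodX // fmodK ?groupX.
(* Now $p$ divides every [M a], hence the count of cosets fixed by $v$. As $\langle v\rangle$ is a
   $p$-group, this count is congruent to the degree. *)
case/negP: degc; rewrite -(markZ_degree abST gamM gamA suppc (fun=> 1)).
have sv : <[v]> \subset S by rewrite cycle_subG.
have n1v : <[v]> \subset 'N(1) by rewrite norm1 subsetT.
have st1 : stabilizes <[v]>%G set0 (fun=> 1 : coset_of T) by move=> h g _; rewrite inE.
have := markZ_pgroup_mod abST gamM gamA pS suppc (sub0set 1%G) sv n1v st1.
rewrite joing1G => /dvdz_trans/(_ (dvdzz _)) dvd1.
rewrite -[X in (_ %| X)%Z](subrK (markZ S c <[v]> set0 (fun=> 1))) rpredD //.
rewrite -(sum_markZ_values abST gamM gamA suppc) rpred_sum // => a _.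
have [ITa | /pM //] := boolP (a \in IT).
by rewrite -/(M a) mE rpredD ?dvdz_mull //; exact: dvdm.
Qed.
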